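(* Let $n\geq 3$. Assume that for every simple atomic relation algebra with atom structure $S$ there is a cylindric atom structure $H$ of dimension $n$ such that (1) if $\mathfrak{Tm}\,S$ is a representable relation algebra then $\mathfrak{Tm}\,H\in\mathsf{RCA}_n$, and (2) $\mathfrak{Cm}\,S$ embeds into the relation algebra reduct $\mathfrak{Ra}\,\mathfrak{Cm}\,H$. Then for all $k\geq 3$ the variety $\mathbf S\mathsf{Nr}_n\mathsf{CA}_{n+k}$ is not closed under completions.
   Context: For an atom structure $S$ (relation or cylindric), $\mathfrak{Cm}\,S$ is the full complex algebra and $\mathfrak{Tm}\,S$ the subalgebra generated by the atoms; the completion of an atomic algebra $\mathfrak A$ is $\mathfrak{Cm}\,\mathrm{At}\mathfrak A$. $\mathsf{RCA}_n$ is the class of representable cylindric algebras of dimension $n$. $\mathfrak{Ra}\,\mathfrak C$ is the relation algebra reduct of a cylindric algebra $\mathfrak C$ of dimension $\ge 3$ (the $2$-neat reduct with composition and converse defined using an extra dimension). $\mathbf S\mathsf{Nr}_n\mathsf{CA}_{n+k}$ is the class of subalgebras of $n$-neat reducts $\{x: \mathsf c_ix=x, n\le i<n+k\}$ of algebras in $\mathsf{CA}_{n+k}$. A class is closed under completions if the completion of every atomic member is a member. *)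

(* Defs.v *)
From Stdlib Require Import Arith.

Definition is_BA {T : Type} (join meet : T -> T -> T) (compl : T -> T)
  (zero one : T) : Prop :=
  (forall x y, join x y = join y x) /\
  (forall x y, meet x y = meet y x) /\
  (forall x y z, join x (join y z) = join (join x y) z) /\
  (forall x y z, meet x (meet y z) = meet (meet x y) z) /\
  (forall x y, join x (meet x y) = x) /\
  (forall x y, meet x (join x y) = x) /\
  (forall x y z, meet x (join y z) = join (meet x y) (meet x z)) /\
  (forall x, join x zero = x) /\
  (forall x, meet x one = x) /\
  (forall x, join x (compl x) = one) /\
  (forall x, meet x (compl x) = zero).

Record RAsig : Type := {
  ra_car :> Type;
  ra_join : ra_car -> ra_car -> ra_car;
  ra_meet : ra_car -> ra_car -> ra_car;
  ra_compl : ra_car -> ra_car;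
  ra_zero : ra_car;
  ra_one : ra_car;
  ra_comp : ra_car -> ra_car -> ra_car;
  ra_conv : ra_car -> ra_car;
  ra_id : ra_car
}.

Definition ra_le (A : RAsig) (x y : A) : Prop := ra_meet A x y = x.

Definition is_RA (A : RAsig) : Prop :=
  is_BA (ra_join A) (ra_meet A) (ra_compl A) (ra_zero A) (ra_one A) /\
  (forall x y z, ra_comp A (ra_comp A x y) z = ra_comp A x (ra_comp A y z)) /\
  (forall x y z, ra_comp A (ra_join A x y) z =
                 ra_join A (ra_comp A x z) (ra_comp A y z)) /\
  (forall x, ra_comp A x (ra_id A) = x) /\
  (forall x, ra_conv A (ra_conv A x) = x) /\
  (forall x y, ra_conv A (ra_join A x y) = ra_join A (ra_conv A x) (ra_conv A y)) /\
  (forall x y, ra_conv A (ra_comp A x y) = ra_comp A (ra_conv A y) (ra_conv A x)) /\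
  (forall x y, ra_le A (ra_comp A (ra_conv A x) (ra_compl A (ra_comp A x y)))
                       (ra_compl A y)).

Definition ra_atom (A : RAsig) (a : A) : Prop :=
  a <> ra_zero A /\ forall y, ra_le A y a -> y = ra_zero A \/ y = a.

Definition atomic_RA (A : RAsig) : Prop :=
  forall x : A, x <> ra_zero A -> exists a, ra_atom A a /\ ra_le A a x.

Definition ra_congruence (A : RAsig) (th : A -> A -> Prop) : Prop :=
  (forall x, th x x) /\ (forall x y, th x y -> th y x) /\
  (forall x y z, th x y -> th y z -> th x z) /\
  (forall x x' y y', th x x' -> th y y' -> th (ra_join A x y) (ra_join A x' y')) /\
  (forall x x' y y', th x x' -> th y y' -> th (ra_meet A x y) (ra_meet A x' y')) /\
  (forall x x' y y', th x x' -> th y y' -> th (ra_comp A x y) (ra_comp A x' y')) /\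
  (forall x x', th x x' -> th (ra_compl A x) (ra_compl A x')) /\
  (forall x x', th x x' -> th (ra_conv A x) (ra_conv A x')).

Definition simple_RA (A : RAsig) : Prop :=
  ra_zero A <> ra_one A /\
  forall th, ra_congruence A th ->
    (forall x y, th x y -> x = y) \/ (forall x y : A, th x y).

Definition ra_hom (A B : RAsig) (h : A -> B) : Prop :=
  (forall x y, h (ra_join A x y) = ra_join B (h x) (h y)) /\
  (forall x y, h (ra_meet A x y) = ra_meet B (h x) (h y)) /\
  (forall x, h (ra_compl A x) = ra_compl B (h x)) /\
  h (ra_zero A) = ra_zero B /\ h (ra_one A) = ra_one B /\
  (forall x y, h (ra_comp A x y) = ra_comp B (h x) (h y)) /\
  (forall x, h (ra_conv A x) = ra_conv B (h x)) /\
  h (ra_id A) = ra_id B.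

Definition injective {X Y : Type} (f : X -> Y) : Prop :=
  forall x y, f x = f y -> x = y.

Record RAatomstr : Type := {
  as_U : Type;
  as_Id : as_U -> Prop;
  as_conv : as_U -> as_U -> Prop;
  as_C : as_U -> as_U -> as_U -> Prop    (* as_C a b c : c <= a ; b *)
}.

Definition AtRA (A : RAsig) : RAatomstr := {|
  as_U := {a : A | ra_atom A a};
  as_Id := fun a => ra_le A (proj1_sig a) (ra_id A);
  as_conv := fun a b => ra_le A (proj1_sig b) (ra_conv A (proj1_sig a));
  as_C := fun a b c => ra_le A (proj1_sig c) (ra_comp A (proj1_sig a) (proj1_sig b))
|}.

Section CmRAops.
Variable S : RAatomstr.
Definition cmr_join (X Y : as_U S -> Prop) := fun u => X u \/ Y u.
Definition cmr_meet (X Y : as_U S -> Prop) := fun u => X u /\ Y u.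
Definition cmr_compl (X : as_U S -> Prop) := fun u => ~ X u.
Definition cmr_zero : as_U S -> Prop := fun _ => False.
Definition cmr_one : as_U S -> Prop := fun _ => True.
Definition cmr_comp (X Y : as_U S -> Prop) :=
  fun c => exists a b, X a /\ Y b /\ as_C S a b c.
Definition cmr_conv (X : as_U S -> Prop) :=
  fun b => exists a, X a /\ as_conv S a b.
Definition cmr_id : as_U S -> Prop := as_Id S.
End CmRAops.

Definition CmRA (S : RAatomstr) : RAsig := {|
  ra_car := as_U S -> Prop;
  ra_join := cmr_join S; ra_meet := cmr_meet S; ra_compl := cmr_compl S;
  ra_zero := cmr_zero S; ra_one := cmr_one S;
  ra_comp := cmr_comp S; ra_conv := cmr_conv S; ra_id := cmr_id S |}.

Inductive genRA (S : RAatomstr) : (as_U S -> Prop) -> Prop :=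
| gr_atom : forall a, genRA S (fun u => u = a)
| gr_join : forall X Y, genRA S X -> genRA S Y -> genRA S (cmr_join S X Y)
| gr_meet : forall X Y, genRA S X -> genRA S Y -> genRA S (cmr_meet S X Y)
| gr_compl : forall X, genRA S X -> genRA S (cmr_compl S X)
| gr_zero : genRA S (cmr_zero S)
| gr_one : genRA S (cmr_one S)
| gr_comp : forall X Y, genRA S X -> genRA S Y -> genRA S (cmr_comp S X Y)
| gr_conv : forall X, genRA S X -> genRA S (cmr_conv S X)
| gr_id : genRA S (cmr_id S).

Definition TmRA (S : RAatomstr) : RAsig := {|
  ra_car := {X : as_U S -> Prop | genRA S X};
  ra_join := fun X Y => exist _ _ (gr_join S _ _ (proj2_sig X) (proj2_sig Y));
  ra_meet := fun X Y => exist _ _ (gr_meet S _ _ (proj2_sig X) (proj2_sig Y));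
  ra_compl := fun X => exist _ _ (gr_compl S _ (proj2_sig X));
  ra_zero := exist _ _ (gr_zero S);
  ra_one := exist _ _ (gr_one S);
  ra_comp := fun X Y => exist _ _ (gr_comp S _ _ (proj2_sig X) (proj2_sig Y));
  ra_conv := fun X => exist _ _ (gr_conv S _ (proj2_sig X));
  ra_id := exist _ _ (gr_id S) |}.

Definition ReE (U : Type) (E : U -> U -> Prop) : RAsig := {|
  ra_car := U -> U -> Prop;
  ra_join := fun X Y a b => X a b \/ Y a b;
  ra_meet := fun X Y a b => X a b /\ Y a b;
  ra_compl := fun X a b => E a b /\ ~ X a b;
  ra_zero := fun _ _ => False;
  ra_one := E;
  ra_comp := fun X Y a c => exists b, X a b /\ Y b c;
  ra_conv := fun X a b => X b a;
  ra_id := fun a b => a = b |}.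

Definition equivalence {U : Type} (E : U -> U -> Prop) : Prop :=
  (forall a, E a a) /\ (forall a b, E a b -> E b a) /\
  (forall a b c, E a b -> E b c -> E a c).

Definition representable_RA (A : RAsig) : Prop :=
  exists (U : Type) (E : U -> U -> Prop) (h : A -> ReE U E),
    equivalence E /\ injective h /\ ra_hom A (ReE U E) h.

(* indices are natural numbers; in dimension m only indices < m matter *)
Record CAsig : Type := {
  ca_car :> Type;
  ca_join : ca_car -> ca_car -> ca_car;
  ca_meet : ca_car -> ca_car -> ca_car;
  ca_compl : ca_car -> ca_car;
  ca_zero : ca_car;
  ca_one : ca_car;
  ca_cyl : nat -> ca_car -> ca_car;
  ca_diag : nat -> nat -> ca_car
}.

Definition ca_le (C : CAsig) (x y : C) : Prop := ca_meet C x y = x.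

Definition is_CA (m : nat) (C : CAsig) : Prop :=
  is_BA (ca_join C) (ca_meet C) (ca_compl C) (ca_zero C) (ca_one C) /\
  (forall i, i < m -> ca_cyl C i (ca_zero C) = ca_zero C) /\
  (forall i x, i < m -> ca_le C x (ca_cyl C i x)) /\
  (forall i x y, i < m ->
     ca_cyl C i (ca_meet C x (ca_cyl C i y)) = ca_meet C (ca_cyl C i x) (ca_cyl C i y)) /\
  (forall i j x, i < m -> j < m -> ca_cyl C i (ca_cyl C j x) = ca_cyl C j (ca_cyl C i x)) /\
  (forall i, i < m -> ca_diag C i i = ca_one C) /\
  (forall i j k, i < m -> j < m -> k < m -> k <> i -> k <> j ->
     ca_diag C i j = ca_cyl C k (ca_meet C (ca_diag C i k) (ca_diag C k j))) /\
  (forall i j x, i < m -> j < m -> i <> j ->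
     ca_meet C (ca_cyl C i (ca_meet C (ca_diag C i j) x))
               (ca_cyl C i (ca_meet C (ca_diag C i j) (ca_compl C x))) = ca_zero C).

Definition ca_atom (C : CAsig) (a : C) : Prop :=
  a <> ca_zero C /\ forall y, ca_le C y a -> y = ca_zero C \/ y = a.

Definition atomic_CA (C : CAsig) : Prop :=
  forall x : C, x <> ca_zero C -> exists a, ca_atom C a /\ ca_le C a x.

Definition ca_hom (n : nat) (A B : CAsig) (h : A -> B) : Prop :=
  (forall x y, h (ca_join A x y) = ca_join B (h x) (h y)) /\
  (forall x y, h (ca_meet A x y) = ca_meet B (h x) (h y)) /\
  (forall x, h (ca_compl A x) = ca_compl B (h x)) /\
  h (ca_zero A) = ca_zero B /\ h (ca_one A) = ca_one B /\
  (forall i x, i < n -> h (ca_cyl A i x) = ca_cyl B i (h x)) /\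
  (forall i j, i < n -> j < n -> h (ca_diag A i j) = ca_diag B i j).

Record CAatomstr : Type := {
  cas_V : Type;
  cas_T : nat -> cas_V -> cas_V -> Prop;
  cas_D : nat -> nat -> cas_V -> Prop
}.

Definition AtCA (C : CAsig) : CAatomstr := {|
  cas_V := {a : C | ca_atom C a};
  cas_T := fun i a b => ca_le C (proj1_sig a) (ca_cyl C i (proj1_sig b));
  cas_D := fun i j a => ca_le C (proj1_sig a) (ca_diag C i j)
|}.

Section CmCAops.
Variable H : CAatomstr.
Definition cmc_join (X Y : cas_V H -> Prop) := fun u => X u \/ Y u.
Definition cmc_meet (X Y : cas_V H -> Prop) := fun u => X u /\ Y u.
Definition cmc_compl (X : cas_V H -> Prop) := fun u => ~ X u.
Definition cmc_zero : cas_V H -> Prop := fun _ => False.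
Definition cmc_one : cas_V H -> Prop := fun _ => True.
Definition cmc_cyl (i : nat) (X : cas_V H -> Prop) :=
  fun a => exists b, X b /\ cas_T H i a b.
Definition cmc_diag (i j : nat) : cas_V H -> Prop := cas_D H i j.
End CmCAops.

Definition CmCA (H : CAatomstr) : CAsig := {|
  ca_car := cas_V H -> Prop;
  ca_join := cmc_join H; ca_meet := cmc_meet H; ca_compl := cmc_compl H;
  ca_zero := cmc_zero H; ca_one := cmc_one H;
  ca_cyl := cmc_cyl H; ca_diag := cmc_diag H |}.

Inductive genCA (n : nat) (H : CAatomstr) : (cas_V H -> Prop) -> Prop :=
| gc_atom : forall a, genCA n H (fun u => u = a)
| gc_join : forall X Y, genCA n H X -> genCA n H Y -> genCA n H (cmc_join H X Y)
| gc_meet : forall X Y, genCA n H X -> genCA n H Y -> genCA n H (cmc_meet H X Y)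
| gc_compl : forall X, genCA n H X -> genCA n H (cmc_compl H X)
| gc_zero : genCA n H (cmc_zero H)
| gc_one : genCA n H (cmc_one H)
| gc_cyl : forall i X, i < n -> genCA n H X -> genCA n H (cmc_cyl H i X)
| gc_diag : forall i j, i < n -> j < n -> genCA n H (cmc_diag H i j).

Definition TmCA_car (n : nat) (H : CAatomstr) := {X : cas_V H -> Prop | genCA n H X}.

(* operations with indices >= n are irrelevant junk (identity / zero) *)
Definition TmCA_cyl (n : nat) (H : CAatomstr) (i : nat) (X : TmCA_car n H)
  : TmCA_car n H :=
  match lt_dec i n with
  | left h => exist _ _ (gc_cyl n H i _ h (proj2_sig X))
  | right _ => X
  end.

Definition TmCA_diag (n : nat) (H : CAatomstr) (i j : nat) : TmCA_car n H :=
  match lt_dec i n, lt_dec j n with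
  | left hi, left hj => exist _ _ (gc_diag n H i j hi hj)
  | _, _ => exist _ _ (gc_zero n H)
  end.

Definition TmCA (n : nat) (H : CAatomstr) : CAsig := {|
  ca_car := TmCA_car n H;
  ca_join := fun X Y => exist _ _ (gc_join n H _ _ (proj2_sig X) (proj2_sig Y));
  ca_meet := fun X Y => exist _ _ (gc_meet n H _ _ (proj2_sig X) (proj2_sig Y));
  ca_compl := fun X => exist _ _ (gc_compl n H _ (proj2_sig X));
  ca_zero := exist _ _ (gc_zero n H);
  ca_one := exist _ _ (gc_one n H);
  ca_cyl := TmCA_cyl n H;
  ca_diag := TmCA_diag n H |}.

(* generalized cylindric set algebra of dimension n with unit
   V = disjoint union over k : K of (Ub k)^n *)
Definition idx (n : nat) := {i : nat | i < n}.

Definition upd {n : nat} {X : Type} (s : idx n -> X) (i : nat) (u : X)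
  : idx n -> X :=
  fun j => if Nat.eq_dec (proj1_sig j) i then u else s j.

Definition Gs (n : nat) (K : Type) (Ub : K -> Type) : CAsig := {|
  ca_car := {k : K & idx n -> Ub k} -> Prop;
  ca_join := fun X Y p => X p \/ Y p;
  ca_meet := fun X Y p => X p /\ Y p;
  ca_compl := fun X p => ~ X p;
  ca_zero := fun _ => False;
  ca_one := fun _ => True;
  ca_cyl := fun i X p =>
    exists u : Ub (projT1 p), X (existT _ (projT1 p) (upd (projT2 p) i u));
  ca_diag := fun i j p =>
    forall a b : idx n, proj1_sig a = i -> proj1_sig b = j ->
      projT2 p a = projT2 p b |}.

(* RCA_n = I Gs_n = S P Cs_n *)
Definition RCA (n : nat) (C : CAsig) : Prop :=
  exists (K : Type) (Ub : K -> Type) (h : C -> Gs n K Ub),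
    injective h /\ ca_hom n C (Gs n K Ub) h.

Definition ca_subst (C : CAsig) (i j : nat) (x : C) : C :=
  ca_cyl C i (ca_meet C (ca_diag C i j) x).

Definition ra_comp_of (C : CAsig) (x y : C) : C :=
  ca_cyl C 2 (ca_meet C (ca_subst C 1 2 x) (ca_subst C 0 2 y)).

Definition ra_conv_of (C : CAsig) (x : C) : C :=
  ca_subst C 2 1 (ca_subst C 1 0 (ca_subst C 0 2 x)).

(* A embeds into Ra C, where C has dimension m: an injective map into the
   2-neat reduct {x | c_i x = x, 2 <= i < m} preserving the RA operations *)
Definition embeds_in_Ra (m : nat) (A : RAsig) (C : CAsig) : Prop :=
  exists f : A -> C,
    injective f /\
    (forall x i, 2 <= i < m -> ca_cyl C i (f x) = f x) /\
    (forall x y, f (ra_join A x y) = ca_join C (f x) (f y)) /\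
    (forall x y, f (ra_meet A x y) = ca_meet C (f x) (f y)) /\
    (forall x, f (ra_compl A x) = ca_compl C (f x)) /\
    f (ra_zero A) = ca_zero C /\ f (ra_one A) = ca_one C /\
    (forall x y, f (ra_comp A x y) = ra_comp_of C (f x) (f y)) /\
    (forall x, f (ra_conv A x) = ra_conv_of C (f x)) /\
    f (ra_id A) = ca_diag C 0 1.

Definition SNr (n m : nat) (C : CAsig) : Prop :=
  exists (D : CAsig) (f : C -> D),
    is_CA m D /\ injective f /\
    (forall x i, n <= i < m -> ca_cyl D i (f x) = f x) /\
    ca_hom n C D f.

(* closure under completions: the completion of an atomic A is Cm At A *)
Definition closed_under_completions (K : CAsig -> Prop) : Prop :=
  forall C : CAsig, K C -> atomic_CA C -> K (CmCA (AtCA C)).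

(* Main.v *)
From Stdlib Require Import Arith Lia Bool Cantor Classical ClassicalEpsilon.
From Stdlib Require Import FunctionalExtensionality PropExtensionality ProofIrrelevance.
Require Import Defs.

(** The hypothesis is applied to the term algebra of a rainbow-like relation
    atom structure [S] for which [Tm S] is representable and [Cm S] is not in
    [S Ra CA_6]; closure under completions would put [Cm S] into
    [S Ra CA_(n + k)], and [n + k >= 6].

    Two cones over a white edge, with green and yellow sides, force a red edge
    between their apexes.  A red atom has a type [(i, j)] (the indices of the
    two greens), a sign and a level.  In a red triangle the product of the signs
    is prescribed by the types, in such a way that four apexes with distinct
    greens are contradictory: every edge lies on two of the four triangles.
    This configuration uses six points.

    The largest two levels of a red triangle are equal, so that the product of
    two red atoms contains finitely many reds.  Hence an element of [Tm S]
    contains finitely or cofinitely many atoms of each red type, and [Tm S] does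
    not see the signs as a whole.  It is represented step by step on the natural
    numbers, with a shade of red (the non-principal ultrafilter of the type)
    wherever a red edge is forced. *)

(** * The rainbow atom structure *)

Inductive colour (V : Type) : Type :=
| Id | Green (i : nat) | Yellow | White | Black | Red (i j : nat) (v : V).
Arguments Id {V}.
Arguments Green {V}.
Arguments Yellow {V}.
Arguments White {V}.
Arguments Black {V}.
Arguments Red {V}.

Definition conv {V : Type} (a : colour V) : colour V :=
  match a with Red i j v => Red j i v | _ => a end.

Definition level : Type := (bool * nat)%type.
Definition atom : Type := colour level.
(* [Red i j None] is the shade of red of type [(i, j)], at level infinity. *)
Definition label : Type := colour (option level).

Definition emb (a : atom) : label :=
  match a with
  | Id => Id | Green i => Green i | Yellow => Yellow
  | White => White | Black => Black | Red i j v => Red i j (Some v)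
  end.

(** Among the four triples from 0, 1, 2, 3 only {0, 1, 2} gives [true], so the prescribed signs of
    the four triangles on four apexes have odd sum. The value is symmetric in the indices, so that
    the sign condition does not depend on how a triangle is read. *)
Definition twist (i j k : nat) : bool :=
  negb ((i =? 3) || (j =? 3) || (k =? 3)).

(* Levels form an ultrametric: the largest of the three occurs twice. *)
Definition level_ok (e : bool) (p q r : option level) : Prop :=
  match p, q, r with
  | Some (s, a), Some (t, b), Some (u, c) =>
      xorb s (xorb t u) = e /\
      ((a = b /\ c <= a) \/ (a = c /\ b <= a) \/ (b = c /\ a <= b))
  | None, Some _, Some _ | Some _, None, Some _ | Some _, Some _, None => False
  | _, _, _ => True
  end.

(* [consistent a b c]: a triangle [u v w] may be labelled [a] on [uv], [b] on [vw]
   and [c] on [uw]. *)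
Definition consistent (a b c : label) : Prop :=
  match a, b, c with
  | Id, _, _ => b = c
  | _, Id, _ => a = c
  | _, _, Id => b = conv a
  | Green _, Green _, (Green _ | White)
  | Green _, White, Green _ | White, Green _, Green _ => False
  | Yellow, Yellow, (Yellow | Black)
  | Yellow, Black, Yellow | Black, Yellow, Yellow => False
  | Green i, Green j, Red k l _ => k = i /\ l = j
  | Green i, Red k l _, Green j => k = i /\ l = j
  | Red k l _, Green i, Green j => k = j /\ l = i
  | Red i j p, Red j' k q, Red i' k' r =>
      i = i' /\ j = j' /\ k = k' /\ level_ok (twist i j k) p q r
  | _, _, _ => True
  end.

Lemma conv_involutive {V : Type} (a : colour V) : conv (conv a) = a.
Proof. now destruct a. Qed.

Lemma emb_conv (a : atom) : emb (conv a) = conv (emb a).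
Proof. now destruct a. Qed.

Lemma twist_swap12 (i j k : nat) : twist j i k = twist i j k.
Proof. unfold twist; now rewrite (orb_comm (j =? 3)). Qed.

Lemma twist_swap23 (i j k : nat) : twist i k j = twist i j k.
Proof.
  unfold twist. now rewrite <- !orb_assoc, (orb_comm (k =? 3)).
Qed.

Lemma level_ok_swap12 (e : bool) (p q r : option level) :
  level_ok e p q r -> level_ok e q p r.
Proof.
  destruct p as [[s a]|], q as [[t b]|], r as [[u c]|]; simpl; try tauto.
  intros [E M]; split; [| lia].
  destruct s, t, u; exact E.
Qed.

Lemma level_ok_swap23 (e : bool) (p q r : option level) :
  level_ok e p q r -> level_ok e p r q.
Proof.
  destruct p as [[s a]|], q as [[t b]|], r as [[u c]|]; simpl; try tauto.
  intros [E M]; split; [| lia].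
  destruct s, t, u; exact E.
Qed.

(** The triangle [u v w] is read as [v u w]. With [cons_conv], which reads it as [w v u], this
    generates all Peircean transforms. *)
Lemma cons_flip_first (a b c : label) : consistent a b c -> consistent (conv a) c b.
Proof.
  destruct a as [ |i| | | |i j p], b as [ |i'| | | |i' j' q],
    c as [ |i''| | | |i'' j'' r]; simpl; try tauto; try congruence;
    try (intros [? ?]; subst; auto; fail).
  intros (-> & -> & -> & H); repeat split; auto.
  rewrite twist_swap12. now apply level_ok_swap23.
Qed.

Lemma cons_conv (a b c : label) :
  consistent a b c -> consistent (conv b) (conv a) (conv c).
Proof.
  destruct a as [ |i| | | |i j p], b as [ |i'| | | |i' j' q],
    c as [ |i''| | | |i'' j'' r]; simpl; try tauto; try congruence;
    try (intros [? ?]; subst; auto; fail).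
  intros (-> & -> & -> & H); repeat split; auto.
  rewrite twist_swap12, twist_swap23, twist_swap12. now apply level_ok_swap12.
Qed.

Lemma cons_flip_second (a b c : label) : consistent a b c -> consistent c (conv b) a.
Proof.
  intro H. apply cons_conv in H. apply cons_flip_first in H.
  apply cons_conv in H. now rewrite !conv_involutive in H.
Qed.

Lemma cons_id_l (b c : label) : consistent Id b c <-> b = c.
Proof. reflexivity. Qed.

Lemma cons_id_r (a c : label) : consistent a Id c <-> a = c.
Proof. destruct a; simpl; try reflexivity; split; congruence. Qed.

Lemma cons_conv_id (a : label) : consistent a (conv a) Id.
Proof. now destruct a. Qed.

Lemma cons_id (a b : label) : consistent a b Id -> b = conv a.
Proof. destruct a, b; simpl; congruence. Qed.

(** * Passing between red atoms of high level and shades *)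

Definition gather (N : nat) (a : label) : label :=
  match a with
  | Red i j (Some (s, l)) => if N <=? l then Red i j None else a
  | _ => a
  end.

(** If one level of a red triangle reaches [N], then so does a second one, by the ultrametric
    condition. At least two edges then become shades, and with two shades no condition on signs is
    left. The conditions involving greens see only the type of a red. *)
Lemma gather_cons (N : nat) (a b c : label) :
  consistent a b c -> consistent (gather N a) (gather N b) (gather N c).
Proof.
  destruct a as [ |i| | | |i j [[s a]|]], b as [ |i'| | | |i' j' [[t b]|]],
    c as [ |i''| | | |i'' j'' [[u c]|]]; simpl; intro H; try exact H;
    try congruence;
    repeat match goal with
      |- context [N <=? ?x] => destruct (Nat.leb_spec N x)
      end; simpl; auto; try congruence; try tauto;
    try (injection H; intros; subst; (reflexivity || lia));
    try (destruct H as (? & ? & ? & ? & ?); repeat split; trivial; lia).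
Qed.

(** A set that is tame from [N] and has [a] as a member contains every such [a']; this is
    [mem_approx]. *)
Definition approx (N : nat) (a' : atom) (a : label) : Prop :=
  emb a' = a \/
  exists i j s l, a = Red i j None /\ a' = Red i j (s, l) /\ N <= l.

Definition lower (N : nat) (a : label) : atom :=
  match a with
  | Id => Id | Green i => Green i | Yellow => Yellow
  | White => White | Black => Black
  | Red i j (Some v) => Red i j v
  | Red i j None => Red i j (true, N)
  end.

Lemma approx_lower (N : nat) (a : label) : approx N (lower N a) a.
Proof.
  destruct a as [ |i| | | |i j [v|]]; try (left; reflexivity).
  right; do 4 eexists; repeat split. apply le_n.
Qed.

Lemma approx_red (N i j : nat) (s : bool) (l : nat) :
  N <= l -> approx N (Red i j (s, l)) (Red i j None).
Proof. right; do 4 eexists; repeat split; auto. Qed.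

(** Lowering each shade to level [N] works unless all three edges are red. In that case [c] has
    finite level, so [a] and [b] are both shades and their atoms can be chosen together. *)
Lemma cons_approx_atom (N : nat) (a b : label) (c : atom) :
  consistent a b (emb c) ->
  exists a' b', approx N a' a /\ approx N b' b /\ consistent (emb a') (emb b') (emb c).
Proof.
  assert (L := approx_lower N).
  intro H.
  destruct (classic (consistent (emb (lower N a)) (emb (lower N b)) (emb c))) as [K|K];
    [eauto 6|].
  destruct a as [ |i| | | |i j [[s a]|]], b as [ |i'| | | |i' j' [[t b]|]],
    c as [ |i''| | | |i'' j'' [u c]]; simpl in H, K; try tauto; try congruence.
  - destruct H as (-> & -> & -> & _).
    (* Two equal levels at or above that of the third edge satisfy the ultrametric condition, and
       the second sign is solved from the sign equation. *)
    exists (Red i'' i' (true, max N c)),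
      (Red i' j'' (xorb u (negb (twist i'' i' j'')), max N c)).
    split; [apply approx_red; lia|]. split; [apply approx_red; lia|].
    simpl. repeat split; [| lia].
    destruct u, (twist i'' i' j''); reflexivity.
Qed.

(** Here the third edge is a shade, to be replaced by a prescribed red atom of level [l]. As [a] and
    [b] are already gathered, their finite levels lie below [N <= l], so at least one of the two is
    free to take level [l] together with the sign that the equation demands. *)
Lemma cons_approx_shade (N i j : nat) (s : bool) (l : nat) (a b : label) :
  gather N a = a -> gather N b = b -> consistent a b (Red i j None) -> N <= l ->
  exists a' b', approx N a' a /\ approx N b' b /\
    consistent (emb a') (emb b') (Red i j (Some (s, l))).
Proof.
  assert (L := approx_lower N).
  intros Ga Gb H Hl.
  destruct (classic
    (consistent (emb (lower N a)) (emb (lower N b)) (Red i j (Some (s, l)))))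
    as [K|K]; [eauto 6|].
  destruct a as [ |k| | | |k k' [[t a]|]], b as [ |m| | | |m m' [[u b]|]];
    simpl in H, K; try tauto; try congruence.
  - injection H as -> ->.
    exists Id, (Red i j (s, l)).
    split; [left; reflexivity|]. split; [now apply approx_red|]. reflexivity.
  - simpl in Ga. destruct (Nat.leb_spec N a); [discriminate|].
    destruct H as (-> & -> & -> & _).
    exists (Red i m (t, a)), (Red m j (xorb (xorb s t) (twist i m j), l)).
    split; [left; reflexivity|]. split; [now apply approx_red|].
    simpl; repeat split; [| lia].
    destruct s, t, (twist i m j); reflexivity.
  - injection H as -> ->.
    exists (Red i j (s, l)), Id.
    split; [now apply approx_red|]. split; [left; reflexivity|]. reflexivity.
  - simpl in Gb. destruct (Nat.leb_spec N b); [discriminate|].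
    destruct H as (-> & -> & -> & _).
    exists (Red i m (xorb (xorb s u) (twist i m j), l)), (Red m j (u, b)).
    split; [now apply approx_red|]. split; [left; reflexivity|].
    simpl; repeat split; [| lia].
    destruct s, u, (twist i m j); reflexivity.
  - destruct H as (-> & -> & -> & _).
    exists (Red i m (true, l)), (Red m j (xorb s (negb (twist i m j)), l)).
    split; [now apply approx_red|]. split; [now apply approx_red|].
    simpl; repeat split; [| lia].
    destruct s, (twist i m j); reflexivity.
Qed.

Definition rainbow : RAatomstr := {|
  as_U := atom;
  as_Id := fun a => a = Id;
  as_conv := fun a b => b = conv a;
  as_C := fun a b c => consistent (emb a) (emb b) (emb c)
|}.

(** * Tame sets and membership of labels *)

Definition tame_from (N : nat) (X : atom -> Prop) : Prop :=
  forall i j, (forall s l, N <= l -> X (Red i j (s, l))) \/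
              (forall s l, N <= l -> ~ X (Red i j (s, l))).

(** One threshold serves all red types at once. Composition relies on this: the reds of type
    [(i, j)] in a product may arise from the types [(i, m)] and [(m, j)] for every [m]. *)
Definition tame (X : atom -> Prop) : Prop := exists N, tame_from N X.

(** On a shade this is membership of [X] in the filter of sets that contain all reds of the type
    from some level on. Restricted to tame sets it is an ultrafilter, whence the clauses for joins
    and complements below. *)
Definition mem (X : atom -> Prop) (a : label) : Prop :=
  match a with
  | Id => X Id | Green i => X (Green i) | Yellow => X Yellow
  | White => X White | Black => X Black
  | Red i j (Some v) => X (Red i j v)
  | Red i j None => exists N, forall s l, N <= l -> X (Red i j (s, l))
  end.

Lemma mem_emb (X : atom -> Prop) (a : atom) : mem X (emb a) <-> X a.
Proof. destruct a; reflexivity. Qed.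

Lemma label_cases (a : label) :
  (exists a', a = emb a') \/ (exists i j, a = Red i j None).
Proof.
  destruct a as [ |i| | | |i j [v|]].
  - left; now exists Id.
  - left; now exists (Green i).
  - left; now exists Yellow.
  - left; now exists White.
  - left; now exists Black.
  - left; now exists (Red i j v).
  - right; eauto.
Qed.

Lemma tame_from_le (N M : nat) (X : atom -> Prop) :
  N <= M -> tame_from N X -> tame_from M X.
Proof.
  intros L T i j. destruct (T i j) as [H|H]; [left|right]; intros; apply H; lia.
Qed.

Lemma tame_common (X Y : atom -> Prop) :
  tame X -> tame Y -> exists N, tame_from N X /\ tame_from N Y.
Proof.
  intros [N TX] [M TY]. exists (max N M).
  split; [apply (tame_from_le N) | apply (tame_from_le M)]; auto; lia.
Qed.

Lemma mem_shade (N : nat) (X : atom -> Prop) (i j : nat) :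
  tame_from N X -> mem X (Red i j None) ->
  forall s l, N <= l -> X (Red i j (s, l)).
Proof.
  intros T [M HM]. destruct (T i j) as [H|H]; [exact H|].
  exfalso. apply (H true (N + M)); [lia|]. apply HM; lia.
Qed.

Lemma mem_approx (N : nat) (X : atom -> Prop) (a' : atom) (a : label) :
  tame_from N X -> approx N a' a -> mem X a -> X a'.
Proof.
  intros T [<- | (i & j & s & l & -> & -> & L)] H.
  - now apply mem_emb in H.
  - now apply (mem_shade N X i j).
Qed.

Lemma mem_gather (N : nat) (X : atom -> Prop) (a : label) :
  tame_from N X -> mem X a -> mem X (gather N a).
Proof.
  intros T H. destruct a as [ |i| | | |i j [[s l]|]]; simpl; auto.
  destruct (Nat.leb_spec N l) as [L|L]; [|exact H].
  destruct (T i j) as [K|K]; [now exists N|]. destruct (K s l L H).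
Qed.

Lemma gather_idem (N : nat) (a : label) : gather N (gather N a) = gather N a.
Proof.
  destruct a as [ |i| | | |i j [[s l]|]]; simpl; auto.
  destruct (Nat.leb_spec N l); simpl; auto.
  destruct (Nat.leb_spec N l); auto; lia.
Qed.

Lemma comp_shade (N : nat) (X Y : atom -> Prop) (a b : label) (i j : nat) :
  tame_from N X -> tame_from N Y -> mem X a -> mem Y b ->
  consistent a b (Red i j None) ->
  forall s l, N <= l -> cmr_comp rainbow X Y (Red i j (s, l)).
Proof.
  intros TX TY Ha Hb H s l L.
  apply (gather_cons N) in H.
  destruct (cons_approx_shade N i j s l (gather N a) (gather N b))
    as (a' & b' & Aa & Ab & C); auto using gather_idem.
  exists a', b'. repeat split; auto.
  - eapply mem_approx; eauto using mem_gather.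
  - eapply mem_approx; eauto using mem_gather.
Qed.

Lemma comp_large (N : nat) (X Y : atom -> Prop) (i j : nat) (s : bool) (l : nat) :
  tame_from N X -> tame_from N Y -> N <= l ->
  cmr_comp rainbow X Y (Red i j (s, l)) ->
  exists a b, mem X a /\ mem Y b /\ consistent a b (Red i j None).
Proof.
  intros TX TY L (a & b & Ha & Hb & C).
  exists (gather N (emb a)), (gather N (emb b)). repeat split.
  - apply mem_gather; auto. now apply mem_emb.
  - apply mem_gather; auto. now apply mem_emb.
  - simpl in C. apply (gather_cons N) in C. simpl in C.
    destruct (Nat.leb_spec N l); [exact C | lia].
Qed.

Lemma tame_comp (X Y : atom -> Prop) :
  tame X -> tame Y -> tame (cmr_comp rainbow X Y).
Proof.
  intros TX TY. destruct (tame_common X Y TX TY) as (N & NX & NY).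
  exists N. intros i j.
  destruct (classic (exists a b, mem X a /\ mem Y b /\ consistent a b (Red i j None)))
    as [(a & b & Ha & Hb & C)|H].
  - left. eapply comp_shade; eauto.
  - right. intros s l L K. apply H. eapply comp_large; eauto.
Qed.

(** Consistent triples of labels describe composition exactly as consistent triples of atoms do. A
    witness for large atoms is gathered into labels, and a witness by labels is approximated by
    atoms at a threshold common to [X] and [Y]. *)
Lemma mem_comp (X Y : atom -> Prop) (c : label) :
  tame X -> tame Y ->
  mem (cmr_comp rainbow X Y) c <->
  exists a b, mem X a /\ mem Y b /\ consistent a b c.
Proof.
  intros TX TY. destruct (tame_common X Y TX TY) as (N & NX & NY).
  destruct (label_cases c) as [[c' ->] | (i & j & ->)].
  - rewrite mem_emb. split.
    + intros (a & b & Ha & Hb & C).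
      exists (emb a), (emb b). now rewrite !mem_emb.
    + intros (a & b & Ha & Hb & C).
      destruct (cons_approx_atom N a b c' C) as (a' & b' & Aa & Ab & C').
      exists a', b'. repeat split; auto; eapply mem_approx; eauto.
  - split.
    + intros [M HM]. apply (comp_large N X Y i j true (N + M)); auto; [lia|].
      apply HM; lia.
    + intros (a & b & Ha & Hb & C). exists N. eapply comp_shade; eauto.
Qed.

Lemma mem_join (X Y : atom -> Prop) (a : label) :
  tame X -> tame Y -> mem (cmr_join rainbow X Y) a <-> mem X a \/ mem Y a.
Proof.
  intros TX TY. destruct (tame_common X Y TX TY) as (N & NX & NY).
  destruct (label_cases a) as [[a' ->] | (i & j & ->)].
  - now rewrite !mem_emb.
  - split.
    + intros [M H]. destruct (NX i j) as [K|K]; [left; now exists N|].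
      right. exists (N + M). intros s l L.
      destruct (H s l) as [Q|Q]; auto; [lia|].
      exfalso. apply (K s l); auto; lia.
    + intros [[M H]|[M H]]; exists M; intros s l L; [left|right]; auto.
Qed.

Lemma mem_meet (X Y : atom -> Prop) (a : label) :
  mem (cmr_meet rainbow X Y) a <-> mem X a /\ mem Y a.
Proof.
  destruct (label_cases a) as [[a' ->] | (i & j & ->)].
  - now rewrite !mem_emb.
  - split.
    + intros [M H]; split; exists M; intros s l L; now apply H.
    + intros [[M H] [M' H']]; exists (M + M'); intros s l L.
      split; [apply H | apply H']; lia.
Qed.

Lemma mem_compl (X : atom -> Prop) (a : label) :
  tame X -> mem (cmr_compl rainbow X) a <-> ~ mem X a.
Proof.
  intros [N T].
  destruct (label_cases a) as [[a' ->] | (i & j & ->)].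
  - now rewrite !mem_emb.
  - split.
    + intros [M H] [M' H']. apply (H true (M + M')); [lia|]. apply H'; lia.
    + intro H. destruct (T i j) as [K|K]; [|now exists N].
      destruct H; now exists N.
Qed.

Lemma mem_conv (X : atom -> Prop) (a : label) :
  mem (cmr_conv rainbow X) a <-> mem X (conv a).
Proof.
  assert (E : forall b, cmr_conv rainbow X b <-> X (conv b)).
  { intro b; split.
    - intros (c & H & E). simpl in E. subst b. now rewrite conv_involutive.
    - intro H. exists (conv b); split; auto. simpl. now rewrite conv_involutive. }
  destruct (label_cases a) as [[a' ->] | (i & j & ->)].
  - now rewrite <- emb_conv, !mem_emb.
  - split; intros [N H]; exists N; intros s l L.
    + now apply (E (Red i j (s, l))), H.
    + now apply E, H.
Qed.

Lemma mem_id (a : label) : mem (cmr_id rainbow) a <-> a = Id.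
Proof.
  destruct a as [ |i| | | |i j [v|]]; simpl; unfold cmr_id; simpl;
    split; try congruence.
  intros [N H]. discriminate (H true N (le_n N)).
Qed.

Lemma genRA_tame (X : atom -> Prop) : genRA rainbow X -> tame X.
Proof.
  induction 1 as [a|X Y _ IX _ IY|X Y _ IX _ IY|X _ IX| | |X Y _ IX _ IY|X _ IX| ].
  - destruct a as [ |i| | | |i j [s l]];
      try (exists 0; right; intros; discriminate).
    (* The threshold is just above the level of the single red atom. *)
    exists (S l). right. intros s' l' L E. injection E; lia.
  - destruct (tame_common X Y IX IY) as (N & NX & NY). exists N. intros i j.
    destruct (NX i j) as [H|H]; [left; intros; left; auto|].
    destruct (NY i j) as [K|K]; [left; intros; right; auto|].
    right. intros s l L [Q|Q]; [eapply H | eapply K]; eauto.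
  - destruct (tame_common X Y IX IY) as (N & NX & NY). exists N. intros i j.
    destruct (NX i j) as [H|H];
      [|right; intros s l L [Q _]; eapply H; eauto].
    destruct (NY i j) as [K|K];
      [|right; intros s l L [_ Q]; eapply K; eauto].
    left. split; auto.
  - destruct IX as [N T]. exists N. intros i j.
    destruct (T i j) as [H|H]; [right | left]; intros s l L; [|now apply H].
    intro Q. apply Q; auto.
  - exists 0. right. intros s l _ [].
  - exists 0. left. intros; exact I.
  - now apply tame_comp.
  - destruct IX as [N T]. exists N. intros i j.
    destruct (T j i) as [H|H]; [left | right]; intros s l L.
    + exists (Red j i (s, l)). split; [auto | reflexivity].
    + intros (a & Ha & E). simpl in E.
      apply (f_equal conv) in E. rewrite conv_involutive in E.
      simpl in E. subst a. eapply H; eauto.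
  - exists 0. right. intros s l _ E. discriminate E.
Qed.

(** * Representation of the term algebra *)

Definition both_green (a b : label) : bool :=
  match a, b with Green _, Green _ => true | _, _ => false end.

Definition both_yellow (a b : label) : bool :=
  match a, b with Yellow, Yellow => true | _, _ => false end.

Definition shade (a b : label) : label :=
  match a, b with Green i, Green j => Red i j None | _, _ => White end.

(* The label of the edge from an old node [t] to a new node [z], where [a, x]
   are the labels on a path from [t] to [z] and [b, y] those on another one. *)
Definition amalgam (a x b y : label) : label :=
  if both_green a x && both_yellow b y then shade a x
  else if both_green b y && both_yellow a x then shade b y
  else if both_green a x || both_green b y then Black else White.

Lemma both_green_yellow (a b : label) :
  both_green a b && both_yellow a b = false.
Proof. now destruct a, b. Qed.

Lemma amalgam_swap (a x b y : label) : amalgam a x b y = amalgam b y a x.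
Proof.
  assert (A := both_green_yellow a x). assert (B := both_green_yellow b y).
  unfold amalgam.
  destruct (both_green a x), (both_yellow a x), (both_green b y), (both_yellow b y);
    try discriminate; reflexivity.
Qed.

(** Two greens exclude white and two yellows exclude black. Hence black is safe without a yellow
    path and white without a green one, and with one path of each kind the shade of the type given
    by the greens is safe. *)
Lemma amalgam_cons (a x b y : label) :
  a <> Id -> x <> Id -> consistent a x (amalgam a x b y).
Proof.
  intros A X. unfold amalgam.
  destruct a, x; simpl; try congruence;
    destruct (both_green b y), (both_yellow b y); simpl; auto;
    destruct b, y; simpl; auto.
Qed.

Lemma amalgam_cases (a x b y : label) :
  amalgam a x b y = White \/ amalgam a x b y = Black \/
  exists i j, amalgam a x b y = Red i j None /\
    ((a = Green i /\ x = Green j /\ y = Yellow) \/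
     (b = Green i /\ y = Green j /\ x = Yellow)).
Proof.
  unfold amalgam.
  destruct (both_green a x && both_yellow b y) eqn:E1.
  { right; right. destruct a, x; try discriminate; destruct b, y; try discriminate.
    simpl. eauto 10. }
  destruct (both_green b y && both_yellow a x) eqn:E2.
  { right; right. destruct b, y; try discriminate; destruct a, x; try discriminate.
    simpl. eauto 10. }
  destruct (both_green a x || both_green b y); auto.
Qed.

Lemma amalgam_not_id (a x b y : label) : amalgam a x b y <> Id.
Proof.
  destruct (amalgam_cases a x b y) as [E|[E|(i & j & E & _)]]; rewrite E; discriminate.
Qed.

(* Two old nodes both joined to the new one by a shade lie on cones over a
   common edge, which fixes the type of a red edge between them. *)
Lemma amalgam_triangle (e a x b y a' b' : label) :
  e <> Id -> consistent e a' a -> consistent e b' b ->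
  consistent e (amalgam a' x b' y) (amalgam a x b y).
Proof.
  intros E A B.
  destruct (amalgam_cases a' x b' y) as [->|[->|(i' & j' & -> & H')]];
    destruct (amalgam_cases a x b y) as [->|[->|(i & j & -> & H)]];
    try (destruct e; simpl; auto; congruence).
  destruct H' as [(-> & -> & ->)|(-> & -> & ->)];
    destruct H as [(-> & Ex & Ey)|(-> & Ey & Ex)]; try discriminate;
    [injection Ex as -> | injection Ey as ->];
    destruct e as [ |k| | | |k l [[s h]|]]; simpl in *;
    try congruence; try tauto;
    try (destruct A; subst; tauto); try (destruct B; subst; tauto).
Qed.

(** * Networks and their one-point extensions *)

Definition network (m : nat) (N : nat -> nat -> label) : Prop :=
  (forall i, i < m -> N i i = Id) /\
  (forall i j, i < m -> j < m -> i <> j -> N i j <> Id) /\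
  (forall i j, i < m -> j < m -> N j i = conv (N i j)) /\
  (forall i j k, i < m -> j < m -> k < m -> consistent (N i j) (N j k) (N i k)).

Definition to_new (N : nat -> nat -> label) (u v : nat) (x y : label) (t : nat)
  : label :=
  if t =? u then x else if t =? v then y else amalgam (N t u) x (N t v) y.

Definition add_node (N : nat -> nat -> label) (m : nat) (P : nat -> label)
  (i j : nat) : label :=
  if i =? m then (if j =? m then Id else conv (P j))
  else if j =? m then P i else N i j.

(** A triangle through exactly one of [u] and [v] is one of the two paths over which its third edge
    was amalgamated. The triangle on both is the hypothesis, and one that avoids both is handled by
    [amalgam_triangle]. *)
Lemma to_new_triangle (m : nat) (N : nat -> nat -> label) (u v : nat) (x y : label) :
  network m N -> u < m -> v < m -> x <> Id -> y <> Id -> consistent (N u v) y x ->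
  forall i j, i < m -> j < m ->
  consistent (N i j) (to_new N u v x y j) (to_new N u v x y i).
Proof.
  intros (NI & ND & NC & NT) Hu Hv X Y C i j Hi Hj.
  destruct (Nat.eq_dec i j) as [<-|Nij]; [now rewrite NI|].
  assert (Ux : forall t, t < m -> t <> u -> forall b z,
    consistent (N t u) x (amalgam (N t u) x b z))
    by (intros; apply amalgam_cons; auto).
  assert (Uy : forall t, t < m -> t <> v -> forall b z,
    consistent (N t v) y (amalgam b z (N t v) y))
    by (intros; rewrite amalgam_swap; apply amalgam_cons; auto).
  unfold to_new.
  destruct (Nat.eqb_spec i u) as [->|Iu]; destruct (Nat.eqb_spec j u) as [->|Ju].
  - congruence.
  - destruct (Nat.eqb_spec j v) as [->|Jv]; auto.
    rewrite (NC j u) by auto. apply cons_flip_first; auto.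
  - destruct (Nat.eqb_spec i v) as [->|Iv]; auto.
    rewrite (NC u v) by auto. now apply cons_flip_first.
  - destruct (Nat.eqb_spec i v) as [->|Iv]; destruct (Nat.eqb_spec j v) as [->|Jv].
    + congruence.
    + rewrite (NC j v) by auto. apply cons_flip_first; auto.
    + auto.
    + apply amalgam_triangle; auto.
Qed.

Lemma network_add_node (m : nat) (N : nat -> nat -> label) (P : nat -> label) :
  network m N -> (forall i, i < m -> P i <> Id) ->
  (forall i j, i < m -> j < m -> consistent (N i j) (P j) (P i)) ->
  network (S m) (add_node N m P).
Proof.
  intros (NI & ND & NC & NT) PD PT.
  unfold add_node; repeat split; intros i; intros;
    repeat match goal with
      |- context [?a =? m] => destruct (Nat.eqb_spec a m); subst; try lia
    end; try congruence; try reflexivity.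
  - apply NI; lia.
  - intro E. apply (PD j); [lia|]. apply (f_equal conv) in E.
    now rewrite conv_involutive in E.
  - apply PD; lia.
  - apply ND; lia.
  - now rewrite conv_involutive.
  - apply NC; lia.
  - rewrite <- (conv_involutive (P j)) at 2. apply cons_conv_id.
  - assert (C := PT j k ltac:(lia) ltac:(lia)). apply cons_flip_first, cons_conv in C.
    now rewrite conv_involutive in C.
  - now apply cons_id_r.
  - apply cons_flip_second, PT; lia.
  - apply PT; lia.
  - apply NT; lia.
Qed.

(** * Enumeration of demands and the limit network *)

Definition decode_label (n : nat) : label :=
  let (k, r) := of_nat n in
  match k with
  | 0 => Id | 1 => Green r | 2 => Yellow | 3 => White | 4 => Black
  | _ =>
      let (i, r1) := of_nat r in
      let (j, r2) := of_nat r1 in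
      let (b, l) := of_nat r2 in
      Red i j (match b with 0 => None | 1 => Some (true, l) | _ => Some (false, l) end)
  end.

Lemma decode_label_surj (a : label) : exists n, decode_label n = a.
Proof.
  destruct a as [ |i| | | |i j v].
  - exists (to_nat (0, 0)). unfold decode_label. now rewrite cancel_of_to.
  - exists (to_nat (1, i)). unfold decode_label. now rewrite cancel_of_to.
  - exists (to_nat (2, 0)). unfold decode_label. now rewrite cancel_of_to.
  - exists (to_nat (3, 0)). unfold decode_label. now rewrite cancel_of_to.
  - exists (to_nat (4, 0)). unfold decode_label. now rewrite cancel_of_to.
  - pose (bl := match v with None => (0, 0) | Some (true, l) => (1, l)
                | Some (false, l) => (2, l) end).
    exists (to_nat (5, to_nat (i, to_nat (j, to_nat bl)))).
    unfold decode_label. rewrite !cancel_of_to.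
    destruct v as [[[|] l]|]; reflexivity.
Qed.

Definition decode (n : nat) : nat * nat * label * label :=
  let (_, r) := of_nat n in
  let (u, r1) := of_nat r in
  let (v, r2) := of_nat r1 in
  let (x, y) := of_nat r2 in
  (u, v, decode_label x, decode_label y).

(* Every demand is met infinitely often, hence after its nodes exist. *)
Lemma decode_surj (u v : nat) (x y : label) (m : nat) :
  exists n, m < n /\ decode n = (u, v, x, y).
Proof.
  destruct (decode_label_surj x) as [x' <-].
  destruct (decode_label_surj y) as [y' <-].
  set (r := to_nat (u, to_nat (v, to_nat (x', y')))).
  exists (to_nat (S m, r)). split.
  - assert (H := to_nat_non_decreasing (S m) r). lia.
  - unfold decode, r. now rewrite !cancel_of_to.
Qed.

Definition admissible (m : nat) (N : nat -> nat -> label)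
  (q : nat * nat * label * label) : Prop :=
  let '(u, v, x, y) := q in
  u < m /\ v < m /\ x <> Id /\ y <> Id /\ consistent (N u v) y x.

(** The default is admissible on every nonempty network, since [N 0 0] is [Id] and the two white
    labels agree. Every stage therefore adds exactly one node. *)
Definition demand (m : nat) (N : nat -> nat -> label) : nat * nat * label * label :=
  if excluded_middle_informative (admissible m N (decode m)) then decode m
  else (0, 0, White, White).

Definition serve (m : nat) (N : nat -> nat -> label) : nat -> nat -> label :=
  let '(u, v, x, y) := demand m N in add_node N m (to_new N u v x y).

Fixpoint stage (m : nat) : nat -> nat -> label :=
  match m with
  | 0 => fun _ _ => Id
  | S m' => serve m' (stage m')
  end.

Lemma stage_network (m : nat) : network m (stage m).
Proof.
  induction m as [|m IH].
  - repeat split; intros; lia.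
  - simpl. unfold serve. destruct (demand m (stage m)) as [[[u v] x] y] eqn:E.
    (* On the empty network the new node has no edge to an old one, so the default demand does no
       harm. *)
    destruct (Nat.eq_dec m 0) as [M|M].
    { subst m. apply network_add_node; auto; intros; lia. }
    assert (A : admissible m (stage m) (u, v, x, y)).
    { unfold demand in E. destruct excluded_middle_informative as [H|H].
      - now rewrite E in H.
      - injection E as <- <- <- <-. repeat split; try lia; try discriminate.
        destruct IH as (NI & _). now rewrite NI by lia. }
    destruct A as (Hu & Hv & X & Y & C).
    apply network_add_node; auto.
    + intros i Hi. unfold to_new.
      destruct (i =? u); auto. destruct (i =? v); auto. apply amalgam_not_id.
    + now apply to_new_triangle.
Qed.

Lemma stage_succ (m i j : nat) : i < m -> j < m -> stage (S m) i j = stage m i j.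
Proof.
  intros Hi Hj. simpl. unfold serve. destruct demand as [[[u v] x] y].
  unfold add_node. destruct (Nat.eqb_spec i m), (Nat.eqb_spec j m); lia || reflexivity.
Qed.

Definition edge (i j : nat) : label := stage (S (max i j)) i j.

Lemma stage_edge (m i j : nat) : i < m -> j < m -> stage m i j = edge i j.
Proof.
  intros Hi Hj. unfold edge.
  assert (H : S (max i j) <= m) by lia. revert H.
  induction 1 as [|m' L IH]; auto.
  rewrite stage_succ by lia. apply IH; lia.
Qed.

Lemma edge_id (i j : nat) : edge i j = Id <-> i = j.
Proof.
  destruct (stage_network (S (max i j))) as (NI & ND & _). split.
  - intro E. destruct (Nat.eq_dec i j) as [|N]; auto.
    exfalso. eapply ND; [| | exact N | exact E]; lia.
  - intros <-. apply NI. lia.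
Qed.

Lemma edge_conv (i j : nat) : edge j i = conv (edge i j).
Proof.
  destruct (stage_network (S (max i j))) as (_ & _ & NC & _).
  rewrite <- !(stage_edge (S (max i j))) by lia. apply NC; lia.
Qed.

Lemma edge_cons (i j k : nat) : consistent (edge i j) (edge j k) (edge i k).
Proof.
  set (m := S (max i (max j k))).
  destruct (stage_network m) as (_ & _ & _ & NT).
  rewrite <- !(stage_edge m) by lia. apply NT; lia.
Qed.

(** Saturation of the limit: it supplies the witnesses for composition and, on a loop, an edge with
    any given label. A label [Id] is witnessed by [u] or [v], any other pair by the node added for
    its demand. *)
Lemma edge_witness (u v : nat) (a b : label) :
  consistent a b (edge u v) -> exists z, edge u z = a /\ edge z v = b.
Proof.
  intro C.
  destruct (classic (a = Id)) as [->|A].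
  { apply cons_id_l in C. exists u. now rewrite edge_id. }
  destruct (classic (b = Id)) as [->|B].
  { apply cons_id_r in C. exists v. now rewrite edge_id. }
  (* A demand lists labels from the old nodes to the new one, so the edge towards [v] enters as its
     converse. *)
  destruct (decode_surj u v a (conv b) (max u v)) as (m & Hm & E).
  assert (Ad : admissible m (stage m) (decode m)).
  { rewrite E. repeat split; try lia; auto.
    - intro K. apply B. rewrite <- (conv_involutive b), K. reflexivity.
    - rewrite stage_edge by lia. now apply cons_flip_second. }
  assert (F : stage (S m) = add_node (stage m) m (to_new (stage m) u v a (conv b))).
  { simpl. unfold serve, demand. destruct excluded_middle_informative; [|tauto].
    now rewrite E. }
  assert (Hu : edge u m = a).
  { rewrite <- (stage_edge (S m)), F by lia. unfold add_node, to_new.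
    destruct (Nat.eqb_spec u m); [lia|]. now rewrite !Nat.eqb_refl. }
  exists m. split; [exact Hu|].
  (* If [u = v], then [to_new] uses only the first label, but consistency over the loop already
     forces [b = conv a]. *)
  destruct (Nat.eq_dec u v) as [<-|N].
  - assert (I : edge u u = Id) by now apply edge_id.
    rewrite I in C. apply cons_id in C. now rewrite edge_conv, Hu.
  - rewrite <- (conv_involutive b), edge_conv. f_equal.
    rewrite <- (stage_edge (S m)), F by lia. unfold add_node, to_new.
    destruct (Nat.eqb_spec v m); [lia|]. rewrite Nat.eqb_refl.
    destruct (Nat.eqb_spec v u); [congruence|]. now rewrite Nat.eqb_refl.
Qed.

(** * The square representation on the natural numbers *)

Definition rep (X : TmRA rainbow) : ReE nat (fun _ _ => True) :=
  fun u v => mem (proj1_sig X) (edge u v).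

Lemma rel_ext (R S : nat -> nat -> Prop) : (forall u v, R u v <-> S u v) -> R = S.
Proof.
  intro H. do 2 (apply functional_extensionality; intro).
  now apply propositional_extensionality.
Qed.

Lemma rep_hom : ra_hom (TmRA rainbow) (ReE nat (fun _ _ => True)) rep.
Proof.
  assert (T : forall X : TmRA rainbow, tame (proj1_sig X))
    by (intros [X G]; now apply genRA_tame).
  unfold ra_hom, rep; simpl; repeat split; intros; apply rel_ext; intros u v; simpl.
  - now apply mem_join.
  - apply mem_meet.
  - rewrite mem_compl by auto. tauto.
  - destruct (label_cases (edge u v)) as [[a ->]|(i & j & ->)].
    + now rewrite mem_emb.
    + split; [|tauto]. intros [N H]. exact (H true N (le_n N)).
  - split; auto. intros _.
    destruct (label_cases (edge u v)) as [[a ->]|(i & j & ->)].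
    + now rewrite mem_emb.
    + exists 0. intros; exact I.
  - rewrite mem_comp by auto. split.
    + intros (a & b & Ha & Hb & C).
      destruct (edge_witness u v a b C) as (z & <- & <-). eauto.
    + intros (z & Ha & Hb). exists (edge u z), (edge z v). auto using edge_cons.
  - rewrite mem_conv. now rewrite (edge_conv u v).
  - rewrite mem_id. apply edge_id.
Qed.

Lemma rep_inj : injective rep.
Proof.
  intros [X GX] [Y GY] E.
  assert (F : X = Y).
  { apply functional_extensionality. intro a. apply propositional_extensionality.
    (* Every atom labels some edge leaving node 0, so an element can be recovered from its image. *)
    destruct (edge_witness 0 0 (emb a) (conv (emb a))) as (z & Hz & _).
    { replace (edge 0 0) with (@Id (option level)) by (symmetry; now apply edge_id).
      apply cons_conv_id. }
    apply (f_equal (fun R => R 0 z)) in E. unfold rep in E. simpl in E.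
    rewrite Hz in E. rewrite <- !mem_emb. now rewrite E. }
  subst Y. f_equal. apply proof_irrelevance.
Qed.

Lemma representation_is_RA (A : RAsig) (U : Type) (h : A -> ReE U (fun _ _ => True)) :
  injective h -> ra_hom A _ h -> is_RA A.
Proof.
  intros I (HJ & HM & HC & HZ & HO & HP & HV & HI).
  assert (X : forall x y, (forall u v, h x u v <-> h y u v) -> x = y).
  { intros x y H. apply I. do 2 (apply functional_extensionality; intro).
    now apply propositional_extensionality. }
  unfold is_RA, is_BA, ra_le; repeat split; intros; apply X; intros u v;
    repeat (rewrite ?HJ, ?HM, ?HC, ?HZ, ?HO, ?HP, ?HV, ?HI; simpl); try tauto;
    try firstorder; try (apply NNPP; tauto).
  all: try (subst; eauto; fail).
Qed.

(** * Cylindric algebras of dimension at least six *)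

Section Cylindric.
Variables (m : nat) (D : CAsig).
Hypothesis Hm : 6 <= m.
Hypothesis HD : is_CA m D.

Local Infix "⊔" := (ca_join D) (at level 50, left associativity).
Local Infix "⊓" := (ca_meet D) (at level 40, left associativity).
Local Notation "∁ x" := (ca_compl D x) (at level 35, right associativity).
Local Notation "⊥" := (ca_zero D).
Local Notation "⊤" := (ca_one D).
Local Infix "⊑" := (ca_le D) (at level 70).
Local Notation c := (ca_cyl D).
Local Notation d := (ca_diag D).

Lemma ca_join_comm x y : x ⊔ y = y ⊔ x.
Proof. apply HD. Qed.
Lemma ca_meet_comm x y : x ⊓ y = y ⊓ x.
Proof. apply HD. Qed.
Lemma ca_meet_assoc x y z : x ⊓ (y ⊓ z) = x ⊓ y ⊓ z.
Proof. apply HD. Qed.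
Lemma ca_join_absorb x y : x ⊔ x ⊓ y = x.
Proof. apply HD. Qed.
Lemma ca_meet_absorb x y : x ⊓ (x ⊔ y) = x.
Proof. apply HD. Qed.
Lemma ca_meet_join x y z : x ⊓ (y ⊔ z) = x ⊓ y ⊔ x ⊓ z.
Proof. apply HD. Qed.
Lemma ca_join_zero x : x ⊔ ⊥ = x.
Proof. apply HD. Qed.
Lemma ca_meet_one x : x ⊓ ⊤ = x.
Proof. apply HD. Qed.
Lemma ca_join_compl x : x ⊔ ∁ x = ⊤.
Proof. apply HD. Qed.
Lemma ca_meet_compl x : x ⊓ ∁ x = ⊥.
Proof. apply HD. Qed.
Lemma cyl_zero i : i < m -> c i ⊥ = ⊥.
Proof. apply HD. Qed.
Lemma cyl_ge i x : i < m -> x ⊑ c i x.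
Proof. apply HD. Qed.
Lemma cyl_meet i x y : i < m -> c i (x ⊓ c i y) = c i x ⊓ c i y.
Proof. apply HD. Qed.
Lemma cyl_comm i j x : i < m -> j < m -> c i (c j x) = c j (c i x).
Proof. apply HD. Qed.
Lemma diag_refl i : i < m -> d i i = ⊤.
Proof. apply HD. Qed.
Lemma diag_cyl i j k : i < m -> j < m -> k < m -> k <> i -> k <> j ->
  d i j = c k (d i k ⊓ d k j).
Proof. apply HD. Qed.
Lemma diag_compl i j x : i < m -> j < m -> i <> j ->
  c i (d i j ⊓ x) ⊓ c i (d i j ⊓ ∁ x) = ⊥.
Proof. apply HD. Qed.

Lemma ca_meet_idem x : x ⊓ x = x.
Proof. rewrite <- (ca_join_absorb x x) at 2. apply ca_meet_absorb. Qed.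
Lemma ca_meet_zero x : x ⊓ ⊥ = ⊥.
Proof. now rewrite <- (ca_meet_compl x), ca_meet_assoc, ca_meet_idem. Qed.
Lemma ca_le_refl x : x ⊑ x.
Proof. apply ca_meet_idem. Qed.
Lemma ca_le_trans x y z : x ⊑ y -> y ⊑ z -> x ⊑ z.
Proof. unfold ca_le. intros H K. now rewrite <- H, <- ca_meet_assoc, K. Qed.
Lemma ca_le_antisym x y : x ⊑ y -> y ⊑ x -> x = y.
Proof. unfold ca_le. intros H K. now rewrite <- H, ca_meet_comm. Qed.
Lemma ca_meet_le_l x y : x ⊓ y ⊑ x.
Proof. unfold ca_le. now rewrite ca_meet_comm, ca_meet_assoc, ca_meet_idem. Qed.
Lemma ca_meet_le_r x y : x ⊓ y ⊑ y.
Proof. rewrite ca_meet_comm. apply ca_meet_le_l. Qed.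
Lemma ca_le_meet x y z : z ⊑ x -> z ⊑ y -> z ⊑ x ⊓ y.
Proof. unfold ca_le. intros H K. now rewrite ca_meet_assoc, H. Qed.
Lemma ca_meet_mono x y x' y' : x ⊑ x' -> y ⊑ y' -> x ⊓ y ⊑ x' ⊓ y'.
Proof.
  intros H K. apply ca_le_meet.
  - apply ca_le_trans with x; auto using ca_meet_le_l.
  - apply ca_le_trans with y; auto using ca_meet_le_r.
Qed.
Lemma ca_le_zero x : x ⊑ ⊥ -> x = ⊥.
Proof. unfold ca_le. intro H. now rewrite <- H, ca_meet_zero. Qed.
Lemma ca_le_one x : x ⊑ ⊤.
Proof. apply ca_meet_one. Qed.
Lemma ca_join_ge_l x y : x ⊑ x ⊔ y.
Proof. apply ca_meet_absorb. Qed.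
Lemma ca_join_ge_r x y : y ⊑ x ⊔ y.
Proof. rewrite ca_join_comm. apply ca_join_ge_l. Qed.
Lemma ca_join_le x y z : x ⊑ z -> y ⊑ z -> x ⊔ y ⊑ z.
Proof.
  unfold ca_le. intros H K.
  now rewrite ca_meet_comm, ca_meet_join, !(ca_meet_comm z), H, K.
Qed.
Lemma ca_le_by_compl x y : x ⊓ ∁ y = ⊥ -> x ⊑ y.
Proof.
  intro H. unfold ca_le.
  rewrite <- (ca_meet_one x) at 2.
  now rewrite <- (ca_join_compl y), ca_meet_join, H, ca_join_zero.
Qed.
Lemma ca_meet_swap x y z : x ⊓ y ⊓ z = x ⊓ z ⊓ y.
Proof. now rewrite <- ca_meet_assoc, (ca_meet_comm y), ca_meet_assoc. Qed.

Lemma cyl_one i : i < m -> c i ⊤ = ⊤.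
Proof. intro H. apply ca_le_antisym; [apply ca_le_one | now apply cyl_ge]. Qed.
Lemma cyl_idem i x : i < m -> c i (c i x) = c i x.
Proof.
  intro H. rewrite <- (ca_meet_one (c i x)) at 1. rewrite ca_meet_comm, cyl_meet; auto.
  now rewrite cyl_one, ca_meet_comm, ca_meet_one.
Qed.
Lemma cyl_mono i x y : i < m -> x ⊑ y -> c i x ⊑ c i y.
Proof.
  intros H L. assert (K : x ⊑ c i y) by (eapply ca_le_trans; eauto using cyl_ge).
  unfold ca_le in *. rewrite <- K at 2. now rewrite cyl_meet.
Qed.
Lemma cyl_meet_closed i x y : i < m -> c i y = y -> c i (x ⊓ y) = c i x ⊓ y.
Proof. intros H E. rewrite <- E at 1. rewrite cyl_meet; auto. now rewrite E. Qed.
Lemma closed_meet i x y : i < m -> c i x = x -> c i y = y -> c i (x ⊓ y) = x ⊓ y.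
Proof. intros H E F. rewrite cyl_meet_closed; auto. now rewrite E. Qed.
Lemma closed_compl i x : i < m -> c i x = x -> c i (∁ x) = ∁ x.
Proof.
  intros H E. apply ca_le_antisym; [|now apply cyl_ge].
  assert (K : c i (∁ x) ⊓ x = ⊥)
    by (rewrite <- cyl_meet_closed, ca_meet_comm, ca_meet_compl; auto using cyl_zero).
  unfold ca_le.
  rewrite <- (ca_meet_one (c i (∁ x))) at 2.
  now rewrite <- (ca_join_compl x), ca_meet_join, K, ca_join_comm, ca_join_zero.
Qed.
(** The complement of [z = c i x ⊔ c i y] is closed under [c i] and disjoint from [x ⊔ y]. It can be
    moved under the cylindrification and is therefore disjoint from [c i (x ⊔ y)] as well. *)
Lemma cyl_join i x y : i < m -> c i (x ⊔ y) = c i x ⊔ c i y.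
Proof.
  intro H. apply ca_le_antisym.
  - apply ca_le_by_compl.
    set (z := c i x ⊔ c i y).
    assert (Z : ∁ z = ∁ c i x ⊓ ∁ c i y).
    { apply ca_le_antisym.
      - apply ca_le_meet; apply ca_le_by_compl.
        + apply ca_le_zero. rewrite <- (ca_meet_compl z), ca_meet_comm.
          apply ca_meet_mono; [|apply ca_le_refl].
          apply ca_le_trans with (c i x); [|apply ca_join_ge_l].
          apply ca_le_by_compl. now rewrite ca_meet_comm, ca_meet_compl.
        + apply ca_le_zero. rewrite <- (ca_meet_compl z), ca_meet_comm.
          apply ca_meet_mono; [|apply ca_le_refl].
          apply ca_le_trans with (c i y); [|apply ca_join_ge_r].
          apply ca_le_by_compl. now rewrite ca_meet_comm, ca_meet_compl.
      - apply ca_le_by_compl. apply ca_le_zero.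
        apply ca_le_trans with ((∁ c i x ⊓ ∁ c i y) ⊓ z).
        + apply ca_meet_mono; [apply ca_le_refl|].
          apply ca_le_by_compl. now rewrite ca_meet_comm, ca_meet_compl.
        + unfold z. rewrite ca_meet_join. apply ca_join_le.
          * rewrite ca_meet_swap, (ca_meet_comm _ (c i x)), ca_meet_compl, ca_meet_comm, ca_meet_zero.
            apply ca_le_refl.
          * rewrite <- ca_meet_assoc, (ca_meet_comm _ (c i y)), ca_meet_compl, ca_meet_zero.
            apply ca_le_refl. }
    assert (Cz : c i (∁ z) = ∁ z).
    { rewrite Z. apply closed_meet; auto; apply closed_compl; auto using cyl_idem. }
    rewrite <- cyl_meet_closed; auto.
    replace ((x ⊔ y) ⊓ ∁ z) with ⊥; [now apply cyl_zero|].
    symmetry. apply ca_le_zero. rewrite <- (ca_meet_compl z).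
    apply ca_meet_mono; [|apply ca_le_refl].
    apply ca_join_le; unfold z; [apply ca_le_trans with (c i x) | apply ca_le_trans with (c i y)];
      auto using cyl_ge, ca_join_ge_l, ca_join_ge_r.
  - apply ca_join_le; apply cyl_mono; auto using ca_join_ge_l, ca_join_ge_r.
Qed.

Lemma cyl_diag i j : i < m -> j < m -> c i (d i j) = ⊤.
Proof.
  intros Hi Hj. destruct (Nat.eq_dec i j) as [<-|N].
  - now rewrite diag_refl, cyl_one.
  - apply ca_le_antisym; [apply ca_le_one|].
    rewrite <- (diag_refl j), (diag_cyl j j i) by auto.
    apply cyl_mono; auto using ca_meet_le_r.
Qed.
Lemma diag_closed i j k : i < m -> j < m -> k < m -> k <> i -> k <> j ->
  c k (d i j) = d i j.
Proof. intros. rewrite (diag_cyl i j k) by auto. now apply cyl_idem. Qed.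
(** On the diagonal, coordinate [i] is determined by [j], so cylindrifying along [i] and returning
    to the diagonal adds nothing; [diag_compl] is this fact in terms of complements. *)
Lemma diag_meet_cyl i j x : i < m -> j < m -> i <> j ->
  d i j ⊓ c i (d i j ⊓ x) = d i j ⊓ x.
Proof.
  intros Hi Hj N. apply ca_le_antisym.
  - apply ca_le_meet; [apply ca_meet_le_l|].
    apply ca_le_by_compl, ca_le_zero. rewrite <- (diag_compl i j x); auto.
    rewrite ca_meet_swap. rewrite ca_meet_comm.
    apply ca_meet_mono; [apply ca_le_refl | auto using cyl_ge].
  - apply ca_le_meet; [apply ca_meet_le_l | auto using cyl_ge].
Qed.
Lemma diag_sym i j : i < m -> j < m -> d i j = d j i.
Proof.
  assert (L : forall a b, a < m -> b < m -> a <> b -> d a b ⊑ d b a).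
  { intros a b Ha Hb N.
    (* The cylindrification of [d b a ⊓ d a b] along [a] is [d b b], hence the unit, which leaves
       [d a b = d b a ⊓ d a b]. *)
    assert (E := diag_meet_cyl a b (d b a) Ha Hb N).
    rewrite (ca_meet_comm (d a b) (d b a)), <- diag_cyl, diag_refl, ca_meet_one in E
      by auto.
    rewrite E. apply ca_meet_le_l. }
  intros Hi Hj. destruct (Nat.eq_dec i j) as [->|N]; auto.
  apply ca_le_antisym; auto.
Qed.

(** * Substitution of one coordinate for another *)

Local Notation s := (ca_subst D).

Lemma subst_mono i j x y : i < m -> x ⊑ y -> s i j x ⊑ s i j y.
Proof. intros. apply cyl_mono; auto. apply ca_meet_mono; auto using ca_le_refl. Qed.
Lemma subst_meet i j x y : i < m -> j < m -> i <> j -> s i j (x ⊓ y) = s i j x ⊓ s i j y.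
Proof.
  intros Hi Hj N. unfold ca_subst. rewrite <- cyl_meet; auto. f_equal.
  rewrite ca_meet_swap, diag_meet_cyl; auto.
  now rewrite ca_meet_assoc, ca_meet_swap.
Qed.
Lemma subst_join i j x y : i < m -> s i j (x ⊔ y) = s i j x ⊔ s i j y.
Proof. intros. unfold ca_subst. now rewrite ca_meet_join, cyl_join. Qed.
Lemma subst_zero i j : i < m -> s i j ⊥ = ⊥.
Proof. intros. unfold ca_subst. now rewrite ca_meet_zero, cyl_zero. Qed.
Lemma subst_one i j : i < m -> j < m -> s i j ⊤ = ⊤.
Proof. intros. unfold ca_subst. now rewrite ca_meet_one, cyl_diag. Qed.
Lemma subst_closed i j x : i < m -> j < m -> c i x = x -> s i j x = x.
Proof.
  intros Hi Hj E. unfold ca_subst. rewrite cyl_meet_closed; auto.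
  now rewrite cyl_diag, ca_meet_comm, ca_meet_one.
Qed.
Lemma cyl_subst i j x : i < m -> c i (s i j x) = s i j x.
Proof. intros. now apply cyl_idem. Qed.
Lemma cyl_subst_comm i j k x : i < m -> j < m -> k < m -> k <> i -> k <> j ->
  c k (s i j x) = s i j (c k x).
Proof.
  intros. unfold ca_subst. rewrite cyl_comm; auto. f_equal.
  rewrite ca_meet_comm, cyl_meet_closed; auto using diag_closed.
  apply ca_meet_comm.
Qed.
Lemma subst_fixed i j k x : i < m -> j < m -> k < m -> k <> i -> k <> j ->
  c k x = x -> c k (s i j x) = s i j x.
Proof. intros. rewrite cyl_subst_comm; auto. congruence. Qed.
Lemma subst_comp i k b z : i < m -> k < m -> b < m ->
  i <> k -> i <> b -> k <> b -> c k z = z -> s k b (s i k z) = s i b z.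
Proof.
  intros Hi Hk Hb N1 N2 N3 E. unfold ca_subst.
  rewrite (ca_meet_comm (d k b)), <- (cyl_meet_closed i) by auto using diag_closed.
  rewrite cyl_comm by auto. f_equal.
  rewrite ca_meet_swap, cyl_meet_closed by auto.
  now rewrite <- diag_cyl by auto.
Qed.
Lemma subst_inv i k z : i < m -> k < m -> i <> k -> c k z = z ->
  s k i (s i k z) = z.
Proof.
  intros Hi Hk N E. unfold ca_subst.
  rewrite (diag_sym k i), diag_meet_cyl by auto.
  rewrite cyl_meet_closed, (diag_sym i k), cyl_diag by auto.
  now rewrite ca_meet_comm, ca_meet_one.
Qed.
Lemma subst_comm i j k l x : i < m -> j < m -> k < m -> l < m ->
  i <> k -> i <> l -> k <> j -> k <> l -> i <> j -> s i j (s k l x) = s k l (s i j x).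
Proof.
  intros. unfold ca_subst.
  rewrite (ca_meet_comm (d i j)), <- (cyl_meet_closed k) by auto using diag_closed.
  rewrite (ca_meet_comm (d k l) (c i _)), <- (cyl_meet_closed i) by auto using diag_closed.
  rewrite cyl_comm by auto. do 2 f_equal.
  now rewrite ca_meet_swap, (ca_meet_comm (d k l)), ca_meet_swap.
Qed.
(** Renaming of a bound variable: the quantified coordinate [i] is replaced by the fresh coordinate
    [k]. *)
Lemma cyl_rename i k z : i < m -> k < m -> i <> k -> c k z = z ->
  c i z = c k (s i k z).
Proof.
  intros Hi Hk N E. unfold ca_subst.
  rewrite cyl_comm, (cyl_meet_closed k) by auto.
  now rewrite diag_sym, cyl_diag, ca_meet_comm, ca_meet_one by auto.
Qed.

(* [pos i j x] moves the two-dimensional element [x] to the coordinates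
   [i <> j]; only [j <> 0] is meaningful. *)
Definition pos (i j : nat) (x : D) : D :=
  let y := if j =? 1 then x else s 1 j x in
  if i =? 0 then y else s 0 i y.

Definition two_dim (x : D) : Prop := forall i, 2 <= i < m -> c i x = x.

Ltac eqb := repeat match goal with
  | |- context [?a =? ?b] => destruct (Nat.eqb_spec a b); try (exfalso; lia)
  end.

Lemma pos_fixed i j k x : two_dim x -> i < m -> j < m -> k < m ->
  j <> 0 -> k <> i -> k <> j -> c k (pos i j x) = pos i j x.
Proof.
  intros T Hi Hj Hk J N1 N2.
  destruct (Nat.eq_dec k 0) as [->|K].
  { unfold pos. eqb; apply cyl_subst; lia. }
  destruct (Nat.eq_dec k 1) as [->|K1].
  { unfold pos. eqb; [|apply subst_fixed; try lia]; apply cyl_subst; lia. }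
  assert (E : c k x = x) by (apply T; lia).
  unfold pos. eqb; repeat (apply subst_fixed; try lia); exact E.
Qed.

Lemma pos_zero i j : pos i j ⊥ = ⊥.
Proof. unfold pos. eqb; rewrite ?subst_zero; auto; lia. Qed.

Lemma pos_one i j : i < m -> j < m -> pos i j ⊤ = ⊤.
Proof. intros. unfold pos. eqb; rewrite ?subst_one; auto; lia. Qed.

Lemma pos_join i j x y : pos i j (x ⊔ y) = pos i j x ⊔ pos i j y.
Proof. unfold pos. eqb; rewrite ?subst_join; auto; lia. Qed.

Lemma pos_meet i j x y : i < m -> j < m -> pos i j (x ⊓ y) = pos i j x ⊓ pos i j y.
Proof. intros. unfold pos. eqb; rewrite ?subst_meet; auto; lia. Qed.

Lemma pos_nonzero j x : two_dim x -> 2 <= j < m -> pos 0 j x = ⊥ -> x = ⊥.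
Proof.
  intros T Hj E. unfold pos in E. revert E. eqb. simpl. intro E.
  rewrite <- (subst_inv 1 j x), E by (try lia; apply T; lia).
  apply subst_zero; lia.
Qed.

Lemma subst_pos_first k b j x : two_dim x -> 2 <= k < m -> b < m -> j < m ->
  b <> 0 -> k <> b -> k <> j -> j <> 0 -> s k b (pos k j x) = pos b j x.
Proof.
  intros T Hk Hb Hj B N1 N2 J.
  assert (E : c k x = x) by (apply T; lia).
  unfold pos. eqb; apply subst_comp; try lia; auto.
  apply subst_fixed; auto; lia.
Qed.

Lemma subst_pos_second k b x : two_dim x -> 2 <= k < m -> b < m ->
  b <> 0 -> k <> b -> s k b (pos 0 k x) = pos 0 b x.
Proof.
  intros T Hk Hb B N.
  assert (E : c k x = x) by (apply T; lia).
  unfold pos. simpl. eqb; subst.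
  - apply subst_inv; auto; lia.
  - apply subst_comp; auto; lia.
Qed.

Lemma subst_pos_last k j x : two_dim x -> 2 <= k < m -> 2 <= j < m -> k <> j ->
  s 1 j (pos k 1 x) = pos k j x.
Proof.
  intros T Hk Hj N. unfold pos. eqb. apply subst_comm; lia.
Qed.

Local Notation comp := (ra_comp_of D).

Lemma two_dim_comp x y : two_dim x -> two_dim y -> two_dim (comp x y).
Proof.
  intros Tx Ty i Hi. unfold ra_comp_of.
  destruct (Nat.eq_dec i 2) as [->|N]; [apply cyl_idem; lia|].
  rewrite cyl_comm by lia. f_equal.
  apply closed_meet; try lia; apply subst_fixed; try lia; auto.
Qed.

Lemma comp_ge_base k x y : two_dim x -> two_dim y -> 2 <= k < m ->
  pos 0 k x ⊓ pos k 1 y ⊑ comp x y.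
Proof.
  intros Tx Ty Hk.
  assert (B : pos 0 2 x ⊓ pos 2 1 y ⊑ comp x y) by (apply cyl_ge; lia).
  destruct (Nat.eq_dec k 2) as [->|K]; auto.
  apply (subst_mono 2 k) in B; [|lia].
  rewrite subst_meet, subst_pos_second, subst_pos_first in B by (auto; lia).
  rewrite (subst_closed 2 k (comp x y)) in B; try lia; auto.
  apply cyl_idem; lia.
Qed.

(** The midpoint is first parked at a spare coordinate [k], so that the endpoint 1 can move to [j];
    only then does the midpoint move to [b], which may be 1 itself. *)
Lemma comp_ge_origin b j x y : two_dim x -> two_dim y ->
  1 <= b < 6 -> 2 <= j < 6 -> b <> j -> pos 0 b x ⊓ pos b j y ⊑ pos 0 j (comp x y).
Proof.
  intros Tx Ty Hb Hj N. assert (Tz := two_dim_comp x y Tx Ty).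
  assert (E : exists k, 2 <= k < 6 /\ k <> b /\ k <> j).
  { destruct (Nat.eq_dec 2 b), (Nat.eq_dec 2 j), (Nat.eq_dec 3 b), (Nat.eq_dec 3 j);
      (exists 4; lia) || (exists 3; lia) || (exists 2; lia). }
  destruct E as (k & Hk & N1 & N2).
  assert (B : pos 0 k x ⊓ pos k 1 y ⊑ comp x y) by (apply comp_ge_base; auto; lia).
  apply (subst_mono 1 j) in B; [|lia].
  rewrite subst_meet, (subst_closed 1 j (pos 0 k x)), subst_pos_last in B
    by (auto; try lia; apply pos_fixed; auto; lia).
  replace (s 1 j (comp x y)) with (pos 0 j (comp x y)) in B by (unfold pos; simpl; eqb; auto).
  apply (subst_mono k b) in B; [|lia].
  rewrite subst_meet, subst_pos_second, subst_pos_first in B by (auto; lia).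
  rewrite (subst_closed k b (pos 0 j _)) in B; auto; try lia.
  apply pos_fixed; auto; lia.
Qed.

Lemma comp_ge i b j x y : two_dim x -> two_dim y ->
  i < b -> b < j -> j < 6 -> pos i b x ⊓ pos b j y ⊑ pos i j (comp x y).
Proof.
  intros Tx Ty Hi Hb Hj.
  assert (B : pos 0 b x ⊓ pos b j y ⊑ pos 0 j (comp x y))
    by (apply comp_ge_origin; auto; lia).
  destruct (Nat.eq_dec i 0) as [->|I]; auto.
  apply (subst_mono 0 i) in B; [|lia].
  rewrite subst_meet, (subst_closed 0 i (pos b j y)) in B
    by (auto; try lia; apply pos_fixed; auto; lia).
  assert (E : forall l z, 0 < l -> s 0 i (pos 0 l z) = pos i l z)
    by (intros; unfold pos; simpl; eqb; reflexivity).
  now rewrite !E in B by lia.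
Qed.

(** With the base edge placed at coordinates 0 and 5, the quantified midpoint of a composition can
    be any of 1, 2, 3, 4. Four compositions over one edge can thus receive four different
    midpoints. *)
Lemma comp_witness k x y : two_dim x -> two_dim y -> 1 <= k < 5 ->
  pos 0 5 (comp x y) = c k (pos 0 k x ⊓ pos k 5 y).
Proof.
  intros Tx Ty Hk.
  assert (B : pos 0 5 (comp x y) = c 2 (pos 0 2 x ⊓ pos 2 5 y)).
  { change (pos 0 5 (comp x y)) with (s 1 5 (c 2 (pos 0 2 x ⊓ pos 2 1 y))).
    rewrite <- cyl_subst_comm, subst_meet by lia. f_equal.
    rewrite subst_pos_last by (auto; lia). f_equal.
    apply subst_closed; try lia. apply pos_fixed; auto; lia. }
  destruct (Nat.eq_dec k 2) as [->|K]; auto.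
  rewrite B, (cyl_rename 2 k), subst_meet, subst_pos_second, subst_pos_first
    by (auto; try lia; apply closed_meet; try lia; apply pos_fixed; auto; lia).
  reflexivity.
Qed.

Lemma triangle_zero i b j p x y z : two_dim x -> two_dim y ->
  i < b -> b < j -> j < 6 -> comp x y ⊓ z = ⊥ ->
  p ⊑ pos i b x -> p ⊑ pos b j y -> p ⊑ pos i j z -> p = ⊥.
Proof.
  intros Tx Ty Hi Hb Hj E Px Py Pz.
  apply ca_le_zero. rewrite <- (pos_zero i j), <- E, pos_meet by lia.
  apply ca_le_meet; auto.
  apply ca_le_trans with (pos i b x ⊓ pos b j y); [now apply ca_le_meet|].
  now apply comp_ge.
Qed.

Lemma split_nonzero p x y : p <> ⊥ -> p ⊑ x ⊔ y ->
  (p ⊓ x <> ⊥) \/ (p ⊓ y <> ⊥).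
Proof.
  intros P L.
  destruct (classic (p ⊓ x = ⊥)) as [E|E]; auto.
  destruct (classic (p ⊓ y = ⊥)) as [F|F]; auto.
  destruct P. unfold ca_le in L. now rewrite <- L, ca_meet_join, E, F, ca_join_zero.
Qed.

Lemma refine_bool (p : D) (x : bool -> D) : p <> ⊥ -> p ⊑ x false ⊔ x true ->
  exists e q, q <> ⊥ /\ q ⊑ p /\ q ⊑ x e.
Proof.
  intros P L. destruct (split_nonzero p _ _ P L) as [H|H].
  - exists false, (p ⊓ x false). auto using ca_meet_le_l, ca_meet_le_r.
  - exists true, (p ⊓ x true). auto using ca_meet_le_l, ca_meet_le_r.
Qed.

(** Among the coordinates 1 to 4, [X k] depends on [k] alone. The four cylindrifications therefore
    distribute over the meet, and [v] lies below the meet of all [c k (X k)]. *)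
Lemma independent_product (X : nat -> D) (v : D) :
  (forall k l, 1 <= k < 5 -> 1 <= l < 5 -> l <> k -> c l (X k) = X k) ->
  (forall k, 1 <= k < 5 -> v ⊑ c k (X k)) -> v <> ⊥ ->
  X 1 ⊓ X 2 ⊓ X 3 ⊓ X 4 <> ⊥.
Proof.
  intros F L V E. apply V, ca_le_zero.
  apply ca_le_trans with (c 1 (c 2 (c 3 (c 4 (X 1 ⊓ X 2 ⊓ X 3 ⊓ X 4))))).
  - rewrite (ca_meet_comm _ (X 4)), cyl_meet_closed
      by (try lia; repeat (apply closed_meet; try lia); apply F; lia).
    rewrite (ca_meet_comm _ (X 3)).
    (* Cylindrifications commute, so a cylindrified factor stays closed under the coordinates still
       to be quantified and can be pulled out. *)
    assert (G : c 3 (c 4 (X 4)) = c 4 (X 4)) by (rewrite cyl_comm, F by lia; auto).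
    assert (G2 : c 2 (c 4 (X 4)) = c 4 (X 4)) by (rewrite cyl_comm, F by lia; auto).
    assert (G1 : c 1 (c 4 (X 4)) = c 4 (X 4)) by (rewrite cyl_comm, F by lia; auto).
    assert (K2 : c 2 (c 3 (X 3)) = c 3 (X 3)) by (rewrite cyl_comm, F by lia; auto).
    assert (K1 : c 1 (c 3 (X 3)) = c 3 (X 3)) by (rewrite cyl_comm, F by lia; auto).
    assert (J1 : c 1 (c 2 (X 2)) = c 2 (X 2)) by (rewrite cyl_comm, F by lia; auto).
    rewrite (ca_meet_comm (c 4 (X 4))), cyl_meet_closed by (try lia; exact G).
    rewrite (cyl_meet_closed 3 (X 3)) by (try lia; apply closed_meet; try lia; apply F; lia).
    rewrite (cyl_meet_closed 2) by (try lia; exact G2).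
    rewrite (ca_meet_comm (c 3 (X 3))), (cyl_meet_closed 2) by (try lia; exact K2).
    rewrite (ca_meet_comm (X 1)), (cyl_meet_closed 2) by (try lia; apply F; lia).
    rewrite (cyl_meet_closed 1) by (try lia; exact G1).
    rewrite (cyl_meet_closed 1) by (try lia; exact K1).
    rewrite (ca_meet_comm (c 2 (X 2))), (cyl_meet_closed 1) by (try lia; exact J1).
    repeat apply ca_le_meet; apply L; lia.
  - rewrite E, !cyl_zero by lia. apply ca_le_refl.
Qed.

(** Coordinates 0 and 5 hold the base edge and 1 to 4 the apexes. The apex at coordinate [k] has
    green index [pred k]. *)
Lemma cones_nonzero (w y : D) (g : nat -> D) :
  two_dim w -> two_dim y -> (forall i, two_dim (g i)) -> w <> ⊥ ->
  (forall i, i < 4 -> w ⊑ comp (g i) y) ->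
  exists p, p <> ⊥ /\ forall k, 1 <= k < 5 -> p ⊑ pos 0 k (g (pred k)) /\ p ⊑ pos k 5 y.
Proof.
  intros Tw Ty Tg W H.
  set (X := fun k => pos 0 k (g (pred k)) ⊓ pos k 5 y).
  assert (F : forall k l, 1 <= k < 5 -> 1 <= l < 5 -> l <> k -> c l (X k) = X k).
  { intros k l Hk Hl N. apply closed_meet; try lia; apply pos_fixed; auto; lia. }
  assert (L : forall k, 1 <= k < 5 -> pos 0 5 w ⊑ c k (X k)).
  { intros k Hk. unfold X. rewrite <- comp_witness by auto.
    assert (E : w ⊑ comp (g (pred k)) y) by (apply H; lia).
    unfold ca_le in *. now rewrite <- pos_meet, E by lia. }
  exists (X 1 ⊓ X 2 ⊓ X 3 ⊓ X 4). split.
  - apply (independent_product X (pos 0 5 w)); auto.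
    intro E. apply W, (pos_nonzero 5); [exact Tw | lia | exact E].
  - intros k Hk.
    assert (P : X 1 ⊓ X 2 ⊓ X 3 ⊓ X 4 ⊑ X k).
    { assert (A : k = 1 \/ k = 2 \/ k = 3 \/ k = 4) by lia.
      destruct A as [->|[->|[->| ->]]].
      - eapply ca_le_trans; [apply ca_meet_le_l|].
        eapply ca_le_trans; apply ca_meet_le_l.
      - eapply ca_le_trans; [apply ca_meet_le_l|].
        eapply ca_le_trans; [apply ca_meet_le_l | apply ca_meet_le_r].
      - eapply ca_le_trans; [apply ca_meet_le_l | apply ca_meet_le_r].
      - apply ca_meet_le_r. }
    split; eapply ca_le_trans; [exact P | apply ca_meet_le_l | exact P | apply ca_meet_le_r].
Qed.

(** Between two apexes, the triangle with coordinate 0 excludes [k i j] and the triangle with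
    coordinate 5 excludes [n], so the edge lies below the join of its two red elements. Choosing a
    sign on each of the six edges leaves a nonzero element whose four triangles must satisfy sign
    equations of odd total. *)
Lemma four_cones_contradiction (w y n : D) (g : nat -> D) (k : nat -> nat -> D)
    (r : nat -> nat -> bool -> D) (tw : nat -> nat -> nat -> bool) :
  two_dim w -> two_dim y -> two_dim n -> (forall i, two_dim (g i)) ->
  (forall i j, two_dim (k i j)) -> (forall i j e, two_dim (r i j e)) ->
  w <> ⊥ ->
  (forall i, i < 4 -> w ⊑ comp (g i) y) ->
  (forall i j, i <> j -> comp (g i) (k i j) ⊓ g j = ⊥) ->
  comp n y ⊓ y = ⊥ ->
  (forall i j, ⊤ ⊑ k i j ⊔ (n ⊔ (r i j false ⊔ r i j true))) ->
  (forall i j l e e' e'', xorb e (xorb e' e'') <> tw i j l ->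
     comp (r i j e) (r j l e') ⊓ r i l e'' = ⊥) ->
  xorb (xorb (tw 0 1 2) (tw 0 1 3)) (xorb (tw 0 2 3) (tw 1 2 3)) = true -> False.
Proof.
  intros Tw Ty Tn Tg Tk Tr W Hw Hk Hn Hcov Hr Htw.
  destruct (cones_nonzero w y g Tw Ty Tg W Hw) as (p & P & Hp).
  assert (Hred : forall a b, 1 <= a -> a < b -> b < 5 ->
    p ⊑ pos a b (r (pred a) (pred b) false) ⊔ pos a b (r (pred a) (pred b) true)).
  { intros a b Ha Hab Hb.
    destruct (Hp a) as [Pa Ya]; [lia|]. destruct (Hp b) as [Pb Yb]; [lia|].
    set (i := pred a) in *; set (j := pred b) in *.
    assert (Z1 : p ⊓ pos a b (k i j) = ⊥).
    { apply (triangle_zero 0 a b _ (g i) (k i j) (g j)); auto; try lia.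
      - apply Hk; lia.
      - eapply ca_le_trans; [apply ca_meet_le_l | exact Pa].
      - apply ca_meet_le_r.
      - eapply ca_le_trans; [apply ca_meet_le_l | exact Pb]. }
    assert (Z2 : p ⊓ pos a b n = ⊥).
    { apply (triangle_zero a b 5 _ n y y); auto; try lia.
      - apply ca_meet_le_r.
      - eapply ca_le_trans; [apply ca_meet_le_l | exact Yb].
      - eapply ca_le_trans; [apply ca_meet_le_l | exact Ya]. }
    assert (E : k i j ⊔ (n ⊔ (r i j false ⊔ r i j true)) = ⊤)
      by (apply ca_le_antisym; [apply ca_le_one | apply Hcov]).
    apply (f_equal (pos a b)) in E. rewrite pos_one, !pos_join in E by lia.
    apply (f_equal (ca_meet D p)) in E.
    rewrite ca_meet_one, !(ca_meet_join p), Z1, Z2 in E.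
    rewrite (ca_join_comm ⊥), ca_join_zero, (ca_join_comm ⊥), ca_join_zero in E.
    unfold ca_le. now rewrite ca_meet_join. }
  assert (Href : forall q a b, q <> ⊥ -> q ⊑ p -> 1 <= a -> a < b -> b < 5 ->
    exists e q', q' <> ⊥ /\ q' ⊑ q /\ q' ⊑ pos a b (r (pred a) (pred b) e)).
  { intros q a b Q L Ha Hab Hb.
    apply (refine_bool q (fun e => pos a b (r (pred a) (pred b) e))); auto.
    eapply ca_le_trans; [exact L | auto]. }
  assert (T := ca_le_trans).
  (* The signs of the six edges are fixed one after another, each time below the previous nonzero
     element. *)
  destruct (Href p 1 2) as (e12 & q1 & Q1 & L1 & R12); auto using ca_le_refl; try lia.
  destruct (Href q1 1 3) as (e13 & q2 & Q2 & L2 & R13); eauto; try lia.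
  assert (M2 : q2 ⊑ p) by eauto.
  destruct (Href q2 1 4) as (e14 & q3 & Q3 & L3 & R14); eauto; try lia.
  assert (M3 : q3 ⊑ p) by eauto.
  destruct (Href q3 2 3) as (e23 & q4 & Q4 & L4 & R23); eauto; try lia.
  assert (M4 : q4 ⊑ p) by eauto.
  destruct (Href q4 2 4) as (e24 & q5 & Q5 & L5 & R24); eauto; try lia.
  assert (M5 : q5 ⊑ p) by eauto.
  destruct (Href q5 3 4) as (e34 & q & Q & L6 & R34); eauto; try lia.
  assert (N4 : q ⊑ q4) by eauto. assert (N3 : q ⊑ q3) by eauto.
  assert (N2 : q ⊑ q2) by eauto. assert (N1 : q ⊑ q1) by eauto.
  simpl in *.
  assert (Par : forall a b l e e' e'', 1 <= a -> a < b -> b < l -> l < 5 ->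
    q ⊑ pos a b (r (pred a) (pred b) e) -> q ⊑ pos b l (r (pred b) (pred l) e') ->
    q ⊑ pos a l (r (pred a) (pred l) e'') ->
    xorb e (xorb e' e'') = tw (pred a) (pred b) (pred l)).
  { intros a b l e e' e'' Ha Hab Hbl Hl A B C.
    destruct (bool_dec (xorb e (xorb e' e'')) (tw (pred a) (pred b) (pred l))); auto.
    destruct Q. eapply (triangle_zero a b l); [| | | | | |exact A|exact B|exact C]; auto. }
  assert (E1 := Par 1 2 3 e12 e23 e13).
  assert (E2 := Par 1 2 4 e12 e24 e14).
  assert (E3 := Par 1 3 4 e13 e34 e14).
  assert (E4 := Par 2 3 4 e23 e34 e24).
  simpl in E1, E2, E3, E4.
  (* In the sum of the four equations every sign occurs twice and cancels. *)
  rewrite <- E1, <- E2, <- E3, <- E4 in Htw; eauto; try lia.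
  destruct e12, e13, e14, e23, e24, e34; discriminate Htw.
Qed.
End Cylindric.

(** * Atom structures of term algebras *)

Lemma set_ext {T : Type} (X Y : T -> Prop) : (forall u, X u <-> Y u) -> X = Y.
Proof.
  intro H. apply functional_extensionality; intro. now apply propositional_extensionality.
Qed.

Lemma sig_ext {T : Type} (P : T -> Prop) (x y : sig P) :
  proj1_sig x = proj1_sig y -> x = y.
Proof.
  destruct x as [x p], y as [y q]; simpl; intros <-. f_equal. apply proof_irrelevance.
Qed.

(** In a square representation a nonzero [z] satisfies [1 ; z ; 1 = 1]. A congruence that identifies
    two distinct elements identifies such a [z] with zero, hence the unit with zero, and so
    collapses everything. *)
Lemma representation_simple (A : RAsig) (U : Type) (h : A -> ReE U (fun _ _ => True)) :
  inhabited U -> injective h -> ra_hom A _ h -> simple_RA A.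
Proof.
  intros [o] I (HJ & HM & HC & HZ & HO & HP & HV & HI).
  assert (X : forall x y, (forall u v, h x u v <-> h y u v) -> x = y).
  { intros x y H. apply I. do 2 (apply functional_extensionality; intro).
    now apply propositional_extensionality. }
  split.
  { intro E. apply (f_equal h) in E. rewrite HZ, HO in E.
    apply (f_equal (fun R => R o o)) in E. simpl in E. now rewrite E. }
  intros th (Tr & Ts & Tt & Tj & Tm & Tc & Tn & _).
  destruct (classic (forall x y, th x y -> x = y)) as [L|L]; [now left|right].
  (* By symmetry of [th] the two identified elements can be ordered so that the first is not below
     the second. *)
  assert (E : exists x y, th x y /\ exists u v, h x u v /\ ~ h y u v).
  { apply NNPP. intro N. apply L. intros x y H. apply X. intros u v.
    split; intro K; apply NNPP; intro M; apply N; [exists x, y | exists y, x]; eauto 6. }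
  destruct E as (x & y & H & u & v & K & M).
  set (z := ra_meet A x (ra_compl A y)).
  assert (Z : th z (ra_zero A)).
  { replace (ra_zero A) with (ra_meet A y (ra_compl A y)); [now apply Tm|].
    apply X. intros. rewrite HM, HC, HZ. simpl. tauto. }
  assert (O : th (ra_one A) (ra_zero A)).
  { replace (ra_one A) with (ra_comp A (ra_one A) (ra_comp A z (ra_one A))).
    - apply Tt with (ra_comp A (ra_one A) (ra_comp A (ra_zero A) (ra_one A))).
      + apply Tc, Tc; auto.
      + replace (ra_comp A (ra_one A) (ra_comp A (ra_zero A) (ra_one A)))
          with (ra_zero A); auto.
        apply X. intros. rewrite !HP, HZ. simpl. firstorder.
    - apply X. intros a b. rewrite !HP, HO. unfold z. rewrite HM, HC. simpl.
      split; auto. intros _. exists u. split; auto. exists v. tauto. }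
  assert (O' : forall t, th t (ra_zero A)).
  { intro t.
    replace t with (ra_meet A t (ra_one A))
      by (apply X; intros; rewrite HM, HO; simpl; tauto).
    replace (ra_zero A) with (ra_meet A t (ra_zero A)); auto.
    apply X; intros; rewrite HM, HZ; simpl; tauto. }
  intros a b. apply Tt with (ra_zero A); auto.
Qed.

Section AtomsOfTmRA.
Variable S : RAatomstr.

Definition ra_single (a : as_U S) : TmRA S := exist _ _ (gr_atom S a).

Lemma TmRA_le (X Y : TmRA S) :
  ra_le (TmRA S) X Y <-> forall u, proj1_sig X u -> proj1_sig Y u.
Proof.
  unfold ra_le. split.
  - intros E u H. rewrite <- E in H. apply H.
  - intro H. apply sig_ext, set_ext. simpl. unfold cmr_meet. firstorder.
Qed.

Lemma TmRA_single_le (a : as_U S) (X : TmRA S) :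
  ra_le (TmRA S) (ra_single a) X <-> proj1_sig X a.
Proof.
  rewrite TmRA_le. simpl. split; [auto | now intros H u ->].
Qed.

Lemma TmRA_nonzero (X : TmRA S) : X <> ra_zero (TmRA S) -> exists u, proj1_sig X u.
Proof.
  intro N. apply NNPP. intro E. apply N, sig_ext, set_ext. intro u. simpl.
  split; [|intros []]. intro H. destruct E. eauto.
Qed.

Lemma ra_single_atom (a : as_U S) : ra_atom (TmRA S) (ra_single a).
Proof.
  split.
  - intro E. apply (f_equal (fun X => proj1_sig X a)) in E. simpl in E.
    change False with (cmr_zero S a). now rewrite <- E.
  - intros y L. rewrite TmRA_le in L.
    destruct (classic (y = ra_zero (TmRA S))) as [|N]; auto. right.
    destruct (TmRA_nonzero y N) as [u Hu].
    apply sig_ext, set_ext. intro v. simpl. split; [apply L|].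
    intros ->. assert (E := L u Hu). simpl in E. now subst u.
Qed.

Lemma TmRA_atomic : atomic_RA (TmRA S).
Proof.
  intros X N. destruct (TmRA_nonzero X N) as [u Hu].
  exists (ra_single u). split; [apply ra_single_atom | now apply TmRA_single_le].
Qed.

(** An isomorphism from [S] onto the atom structure of its term algebra. It is needed because the
    hypothesis of the theorem speaks of the atom structure of an algebra rather than of [S]. *)
Definition ra_iota (a : as_U S) : as_U (AtRA (TmRA S)) :=
  exist _ (ra_single a) (ra_single_atom a).

Lemma ra_iota_inj (a b : as_U S) : ra_iota a = ra_iota b -> a = b.
Proof.
  intro E. apply (f_equal (fun x => proj1_sig (proj1_sig x) a)) in E. simpl in E.
  now rewrite <- E.
Qed.

Lemma ra_iota_surj (x : as_U (AtRA (TmRA S))) : exists a, ra_iota a = x.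
Proof.
  destruct x as [X [N M]]. destruct (TmRA_nonzero X N) as [u Hu].
  exists u. apply sig_ext. simpl.
  destruct (M (ra_single u)) as [E|E]; auto.
  - now apply TmRA_single_le.
  - now apply ra_single_atom in E.
Qed.

Lemma ra_iota_Id (a : as_U S) : as_Id (AtRA (TmRA S)) (ra_iota a) <-> as_Id S a.
Proof. simpl. now rewrite TmRA_single_le. Qed.

Lemma ra_iota_conv (a b : as_U S) :
  as_conv (AtRA (TmRA S)) (ra_iota a) (ra_iota b) <-> as_conv S a b.
Proof.
  simpl. rewrite TmRA_single_le. simpl. unfold cmr_conv.
  split; [now intros (? & -> & ?) | eauto].
Qed.

Lemma ra_iota_C (a b c : as_U S) :
  as_C (AtRA (TmRA S)) (ra_iota a) (ra_iota b) (ra_iota c) <-> as_C S a b c.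
Proof.
  simpl. rewrite TmRA_single_le. simpl. unfold cmr_comp.
  split; [now intros (? & ? & -> & -> & ?) | eauto 6].
Qed.

Definition ra_pull (X : as_U (AtRA (TmRA S)) -> Prop) : as_U S -> Prop :=
  fun a => X (ra_iota a).

Lemma ra_pull_inj (X Y : as_U (AtRA (TmRA S)) -> Prop) :
  ra_pull X = ra_pull Y -> X = Y.
Proof.
  intro E. apply functional_extensionality. intro x.
  destruct (ra_iota_surj x) as [a <-]. now apply (f_equal (fun P => P a)) in E.
Qed.

Lemma ra_pull_comp (X Y : as_U (AtRA (TmRA S)) -> Prop) :
  ra_pull (cmr_comp _ X Y) = cmr_comp S (ra_pull X) (ra_pull Y).
Proof.
  apply set_ext. intro c. split.
  - intros (x & y & HX & HY & C).
    destruct (ra_iota_surj x) as [a <-], (ra_iota_surj y) as [b <-].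
    exists a, b. now rewrite <- ra_iota_C.
  - intros (a & b & HX & HY & C).
    exists (ra_iota a), (ra_iota b). now rewrite ra_iota_C.
Qed.

Lemma ra_pull_conv (X : as_U (AtRA (TmRA S)) -> Prop) :
  ra_pull (cmr_conv _ X) = cmr_conv S (ra_pull X).
Proof.
  apply set_ext. intro c. split.
  - intros (x & HX & C). destruct (ra_iota_surj x) as [a <-].
    exists a. now rewrite <- ra_iota_conv.
  - intros (a & HX & C). exists (ra_iota a). now rewrite ra_iota_conv.
Qed.

Lemma ra_pull_id : ra_pull (cmr_id _) = cmr_id S.
Proof. apply set_ext. apply ra_iota_Id. Qed.

Lemma ra_pull_gen (X : as_U (AtRA (TmRA S)) -> Prop) :
  genRA _ X -> genRA S (ra_pull X).
Proof.
  induction 1 as [x|X Y _ IX _ IY|X Y _ IX _ IY|X _ IX| | |X Y _ IX _ IY|X _ IX| ].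
  - destruct (ra_iota_surj x) as [a <-].
    replace (ra_pull (fun u => u = ra_iota a)) with (fun u => u = a); [constructor|].
    apply set_ext. intro u. unfold ra_pull. split; [now intros ->|apply ra_iota_inj].
  - exact (gr_join S _ _ IX IY).
  - exact (gr_meet S _ _ IX IY).
  - exact (gr_compl S _ IX).
  - exact (gr_zero S).
  - exact (gr_one S).
  - rewrite ra_pull_comp. now constructor.
  - rewrite ra_pull_conv. now constructor.
  - rewrite ra_pull_id. constructor.
Qed.

Lemma representable_AtRA :
  representable_RA (TmRA S) -> representable_RA (TmRA (AtRA (TmRA S))).
Proof.
  intros (U & E & h & Eq & I & HJ & HM & HC & HZ & HO & HP & HV & HI).
  set (q := fun X : TmRA (AtRA (TmRA S)) =>
    exist (genRA S) (ra_pull (proj1_sig X)) (ra_pull_gen _ (proj2_sig X)) : TmRA S).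
  exists U, E, (fun X => h (q X)). split; [exact Eq|]. split.
  - intros X Y H. apply I in H. apply sig_ext, ra_pull_inj.
    exact (f_equal (@proj1_sig _ _) H).
  - repeat split; intros.
    + rewrite <- HJ. f_equal. now apply sig_ext.
    + rewrite <- HM. f_equal. now apply sig_ext.
    + rewrite <- HC. f_equal. now apply sig_ext.
    + rewrite <- HZ. f_equal. now apply sig_ext.
    + rewrite <- HO. f_equal. now apply sig_ext.
    + rewrite <- HP. f_equal. apply sig_ext, ra_pull_comp.
    + rewrite <- HV. f_equal. apply sig_ext, ra_pull_conv.
    + rewrite <- HI. f_equal. apply sig_ext, ra_pull_id.
Qed.

Definition ra_push (X : as_U S -> Prop) : as_U (AtRA (TmRA S)) -> Prop :=
  fun x => exists a, X a /\ ra_iota a = x.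

Lemma ra_pull_push (X : as_U S -> Prop) : ra_pull (ra_push X) = X.
Proof.
  apply set_ext. intro a. split.
  - intros (b & H & E). now rewrite <- (ra_iota_inj _ _ E).
  - intro H. now exists a.
Qed.

Lemma ra_push_inj : injective ra_push.
Proof. intros X Y E. now rewrite <- (ra_pull_push X), E, ra_pull_push. Qed.

Lemma ra_push_hom : ra_hom (CmRA S) (CmRA (AtRA (TmRA S))) ra_push.
Proof.
  repeat split; intros; apply ra_pull_inj; simpl;
    rewrite ?ra_pull_comp, ?ra_pull_conv, ?ra_pull_id, !ra_pull_push; try reflexivity.
  - apply set_ext. intro u. change (ra_pull (cmr_join _ (ra_push x) (ra_push y)) u)
      with (ra_pull (ra_push x) u \/ ra_pull (ra_push y) u).
    now rewrite !ra_pull_push.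
  - apply set_ext. intro u. change (ra_pull (cmr_meet _ (ra_push x) (ra_push y)) u)
      with (ra_pull (ra_push x) u /\ ra_pull (ra_push y) u).
    now rewrite !ra_pull_push.
  - apply set_ext. intro u. change (ra_pull (cmr_compl _ (ra_push x)) u)
      with (~ ra_pull (ra_push x) u).
    now rewrite !ra_pull_push.
  - symmetry. apply ra_pull_id.
Qed.
End AtomsOfTmRA.

Section AtomsOfTmCA.
Variables (n : nat) (H : CAatomstr).

Definition ca_single (a : cas_V H) : TmCA n H := exist _ _ (gc_atom n H a).

Lemma TmCA_le (X Y : TmCA n H) :
  ca_le (TmCA n H) X Y <-> forall u, proj1_sig X u -> proj1_sig Y u.
Proof.
  unfold ca_le. split.
  - intros E u K. rewrite <- E in K. apply K.
  - intro K. apply sig_ext, set_ext. simpl. unfold cmc_meet. firstorder.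
Qed.

Lemma TmCA_single_le (a : cas_V H) (X : TmCA n H) :
  ca_le (TmCA n H) (ca_single a) X <-> proj1_sig X a.
Proof.
  rewrite TmCA_le. simpl. split; [auto | now intros K u ->].
Qed.

Lemma TmCA_nonzero (X : TmCA n H) : X <> ca_zero (TmCA n H) -> exists u, proj1_sig X u.
Proof.
  intro N. apply NNPP. intro E. apply N, sig_ext, set_ext. intro u. simpl.
  split; [|intros []]. intro K. destruct E. eauto.
Qed.

Lemma ca_single_atom (a : cas_V H) : ca_atom (TmCA n H) (ca_single a).
Proof.
  split.
  - intro E. apply (f_equal (fun X : TmCA n H => proj1_sig X a)) in E. simpl in E.
    change False with (cmc_zero H a). now rewrite <- E.
  - intros y L. rewrite TmCA_le in L.
    destruct (classic (y = ca_zero (TmCA n H))) as [|N]; auto. right.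
    destruct (TmCA_nonzero y N) as [u Hu].
    apply sig_ext, set_ext. intro v. simpl. split; [apply L|].
    intros ->. assert (E := L u Hu). simpl in E. now subst u.
Qed.

Lemma TmCA_atomic : atomic_CA (TmCA n H).
Proof.
  intros X N. destruct (TmCA_nonzero X N) as [u Hu].
  exists (ca_single u). split; [apply ca_single_atom | now apply TmCA_single_le].
Qed.

Definition ca_iota (a : cas_V H) : cas_V (AtCA (TmCA n H)) :=
  exist _ (ca_single a) (ca_single_atom a).

Lemma ca_iota_inj (a b : cas_V H) : ca_iota a = ca_iota b -> a = b.
Proof.
  intro E. apply (f_equal (fun x => proj1_sig (proj1_sig x : TmCA n H) a)) in E.
  simpl in E. now rewrite <- E.
Qed.

Lemma ca_iota_surj (x : cas_V (AtCA (TmCA n H))) : exists a, ca_iota a = x.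
Proof.
  destruct x as [X [N M]]. destruct (TmCA_nonzero X N) as [u Hu].
  exists u. apply sig_ext. simpl.
  destruct (M (ca_single u)) as [E|E]; auto.
  - now apply TmCA_single_le.
  - now apply ca_single_atom in E.
Qed.

Lemma ca_iota_T (i : nat) (a b : cas_V H) : i < n ->
  cas_T (AtCA (TmCA n H)) i (ca_iota a) (ca_iota b) <-> cas_T H i a b.
Proof.
  intro L. simpl. rewrite TmCA_single_le. unfold TmCA_cyl.
  destruct (lt_dec i n) as [L'|L']; [|lia]. simpl. unfold cmc_cyl.
  split; [now intros (? & -> & ?) | eauto].
Qed.

Lemma ca_iota_D (i j : nat) (a : cas_V H) : i < n -> j < n ->
  cas_D (AtCA (TmCA n H)) i j (ca_iota a) <-> cas_D H i j a.
Proof.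
  intros Li Lj. simpl. rewrite TmCA_single_le. unfold TmCA_diag.
  destruct (lt_dec i n); [|lia]. destruct (lt_dec j n); [|lia]. reflexivity.
Qed.

Definition ca_push (X : CmCA H) : CmCA (AtCA (TmCA n H)) :=
  fun x => exists a, X a /\ ca_iota a = x.

Lemma ca_push_iota (X : CmCA H) (a : cas_V H) : ca_push X (ca_iota a) <-> X a.
Proof.
  split.
  - intros (b & K & E). now rewrite <- (ca_iota_inj _ _ E).
  - intro K. now exists a.
Qed.

Lemma ca_push_inj : injective ca_push.
Proof.
  intros X Y E. apply set_ext. intro a. now rewrite <- ca_push_iota, E, ca_push_iota.
Qed.

(** Closure under completions speaks of the complex algebra over the atoms of the term algebra; this
    carries [CmCA H] into it. The two agree only on indices below [n], as the term algebra has junk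
    operations beyond. *)
Lemma ca_push_hom : ca_hom n (CmCA H) (CmCA (AtCA (TmCA n H))) ca_push.
Proof.
  repeat split; intros; apply set_ext; intro z;
    destruct (ca_iota_surj z) as [a <-]; rewrite ca_push_iota; simpl.
  - unfold cmc_join. now rewrite !ca_push_iota.
  - unfold cmc_meet. now rewrite !ca_push_iota.
  - unfold cmc_compl. now rewrite !ca_push_iota.
  - reflexivity.
  - reflexivity.
  - unfold cmc_cyl. split.
    + intros (b & K & T). exists (ca_iota b). rewrite ca_push_iota.
      split; auto. now apply ca_iota_T.
    + intros (z & K & T). destruct (ca_iota_surj z) as [b <-].
      exists b. rewrite ca_push_iota in K. split; auto. now apply ca_iota_T in T.
  - unfold cmc_diag. symmetry. now apply ca_iota_D.
Qed.
End AtomsOfTmCA.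

(** * Cylindric set algebras *)

Section SetAlgebras.
Variables (K : Type) (Ub : K -> Type).

Lemma idx_ext (n : nat) (a b : idx n) : proj1_sig a = proj1_sig b -> a = b.
Proof. apply sig_ext. Qed.

Lemma upd_upd_same {n : nat} {X : Type} (s : idx n -> X) (i : nat) (u v : X) :
  upd (upd s i u) i v = upd s i v.
Proof.
  apply functional_extensionality. intro j. unfold upd. now destruct Nat.eq_dec.
Qed.

Lemma upd_comm {n : nat} {X : Type} (s : idx n -> X) (i j : nat) (u v : X) :
  i <> j -> upd (upd s i u) j v = upd (upd s j v) i u.
Proof.
  intro N. apply functional_extensionality. intro k. unfold upd.
  destruct (Nat.eq_dec (proj1_sig k) j), (Nat.eq_dec (proj1_sig k) i); congruence.
Qed.

Lemma upd_self {n : nat} {X : Type} (s : idx n -> X) (i : nat) (H : i < n) :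
  upd s i (s (exist _ i H)) = s.
Proof.
  apply functional_extensionality. intro k. unfold upd.
  destruct Nat.eq_dec as [E|]; auto. f_equal. now apply idx_ext.
Qed.

Lemma upd_eq {n : nat} {X : Type} (s : idx n -> X) (i : nat) (u : X) (k : idx n) :
  proj1_sig k = i -> upd s i u k = u.
Proof. intro E. unfold upd. now destruct Nat.eq_dec. Qed.

Lemma upd_neq {n : nat} {X : Type} (s : idx n -> X) (i : nat) (u : X) (k : idx n) :
  proj1_sig k <> i -> upd s i u k = s k.
Proof. intro E. unfold upd. now destruct Nat.eq_dec. Qed.

Lemma Gs_diag (m i j : nat) (Hi : i < m) (Hj : j < m) (k : K) (s : idx m -> Ub k) :
  ca_diag (Gs m K Ub) i j (existT _ k s) <->
  s (exist _ i Hi) = s (exist _ j Hj).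
Proof.
  split.
  - intro H. now apply H.
  - intros E a b Ea Eb. simpl.
    replace a with (exist (fun i => i < m) i Hi) by now apply idx_ext.
    replace b with (exist (fun i => i < m) j Hj) by now apply idx_ext.
    exact E.
Qed.

Lemma Gs_is_CA (m : nat) : is_CA m (Gs m K Ub).
Proof.
  split; [|split; [|split; [|split; [|split; [|split; [|split]]]]]].
  - unfold is_BA; repeat split; intros; apply set_ext; intro; simpl;
      try tauto.
  - intros. apply set_ext. intros [k s]. simpl. firstorder.
  - intros i X Hi. apply set_ext. intros [k s]. simpl. split; [tauto|].
    intro H. split; auto. exists (s (exist _ i Hi)). now rewrite upd_self.
  - intros i X Y Hi. apply set_ext. intros [k s]. simpl. split.
    + intros (u & HX & v & HY). rewrite upd_upd_same in HY. eauto.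
    + intros [(u & HX) (v & HY)]. exists u. split; auto. exists v.
      now rewrite upd_upd_same.
  - intros i j X Hi Hj. apply set_ext. intros [k s]. simpl.
    destruct (Nat.eq_dec i j) as [->|N]; [reflexivity|].
    split; intros (u & v & HX); exists v, u; rewrite upd_comm; auto.
  - intros i Hi. apply set_ext. intros [k s]. rewrite (Gs_diag m i i Hi Hi).
    simpl. tauto.
  - intros i j l Hi Hj Hl Ni Nj. apply set_ext. intros [k s].
    rewrite (Gs_diag m i j Hi Hj).
    change (s (exist _ i Hi) = s (exist _ j Hj) <->
      exists u : Ub k, ca_diag (Gs m K Ub) i l (existT _ k (upd s l u)) /\
                       ca_diag (Gs m K Ub) l j (existT _ k (upd s l u))).
    split.
    + intro E. exists (s (exist _ i Hi)).
      rewrite (Gs_diag m i l Hi Hl), (Gs_diag m l j Hl Hj).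
      rewrite !(upd_eq s l _ (exist _ l Hl)), !upd_neq by (simpl; auto). auto.
    + intros (u & E & F). revert E F.
      rewrite (Gs_diag m i l Hi Hl), (Gs_diag m l j Hl Hj).
      rewrite !(upd_eq s l _ (exist _ l Hl)), !upd_neq by (simpl; auto). congruence.
  - intros i j X Hi Hj N. apply set_ext. intros [k s].
    change ((exists u : Ub k, ca_diag (Gs m K Ub) i j (existT _ k (upd s i u)) /\
               X (existT _ k (upd s i u))) /\
            (exists u : Ub k, ca_diag (Gs m K Ub) i j (existT _ k (upd s i u)) /\
               ~ X (existT _ k (upd s i u))) <-> False).
    split; [|intros []]. intros [(u & E & HX) (v & F & HY)]. revert E F.
    rewrite !(Gs_diag m i j Hi Hj).
    rewrite !(upd_eq s i _ (exist _ i Hi)), !upd_neq by (simpl; auto).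
    intros -> ->. auto.
Qed.

Variables n m : nat.
Hypothesis Hnm : n <= m.

Definition widen (j : idx n) : idx m :=
  exist _ (proj1_sig j) (Nat.lt_le_trans _ _ _ (proj2_sig j) Hnm).

(** The cylinder over [X]: the coordinates from [n] on are left free, which is why the image lies in
    the neat reduct. *)
Definition lift (X : Gs n K Ub) : Gs m K Ub :=
  fun p => X (existT _ (projT1 p) (fun j => projT2 p (widen j))).

Lemma lift_inj : 0 < n -> injective lift.
Proof.
  intros Hn X Y E. apply functional_extensionality. intros [k s].
  (* The new coordinates repeat coordinate 0, which provides a point of the base because [0 < n]. *)
  set (t := fun j : idx m =>
    match lt_dec (proj1_sig j) n with
    | left h => s (exist _ (proj1_sig j) h)
    | right _ => s (exist _ 0 Hn)
    end).
  apply (f_equal (fun Z => Z (existT _ k t))) in E. unfold lift in E. simpl in E.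
  replace (fun j => t (widen j)) with s in E; auto.
  apply functional_extensionality. intros [j h]. unfold t. simpl.
  destruct (lt_dec j n); [|lia]. f_equal. now apply idx_ext.
Qed.

Lemma lift_hom : ca_hom n (Gs n K Ub) (Gs m K Ub) lift.
Proof.
  repeat split; trivial.
  intros i j Hi Hj. apply set_ext. intros [k s].
  change (ca_diag (Gs n K Ub) i j (existT _ k (fun a => s (widen a))) <->
          ca_diag (Gs m K Ub) i j (existT _ k s)).
  rewrite (Gs_diag n i j Hi Hj).
  assert (Hi' : i < m) by lia. assert (Hj' : j < m) by lia.
  rewrite (Gs_diag m i j Hi' Hj').
  replace (widen (exist _ i Hi)) with (exist (fun i => i < m) i Hi') by now apply idx_ext.
  replace (widen (exist _ j Hj)) with (exist (fun i => i < m) j Hj') by now apply idx_ext.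
  reflexivity.
Qed.

Lemma lift_closed (X : Gs n K Ub) (i : nat) : n <= i < m ->
  ca_cyl (Gs m K Ub) i (lift X) = lift X.
Proof.
  intro Hi.
  assert (E : forall k (s : idx m -> Ub k) u,
    (fun j => upd s i u (widen j)) = (fun j => s (widen j))).
  { intros. apply functional_extensionality. intros [j h]. apply upd_neq. simpl. lia. }
  assert (Hi' : i < m) by lia.
  apply set_ext. intros [k s]. unfold lift. simpl. split.
  - intros (u & H). now rewrite E in H.
  - intro H. exists (s (exist _ i Hi')). now rewrite E.
Qed.
End SetAlgebras.

Lemma ca_hom_compose (n : nat) (A B C : CAsig) (f : A -> B) (g : B -> C) :
  ca_hom n A B f -> ca_hom n B C g -> ca_hom n A C (fun x => g (f x)).
Proof.
  intros (F1 & F2 & F3 & F4 & F5 & F6 & F7) (G1 & G2 & G3 & G4 & G5 & G6 & G7).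
  repeat split; intros.
  - now rewrite F1, G1.
  - now rewrite F2, G2.
  - now rewrite F3, G3.
  - now rewrite F4, G4.
  - now rewrite F5, G5.
  - now rewrite F6, G6.
  - now rewrite F7, G7.
Qed.

Lemma RCA_SNr (n m : nat) (C : CAsig) : 0 < n -> n <= m -> RCA n C -> SNr n m C.
Proof.
  intros Hn L (K & Ub & h & I & Hh).
  exists (Gs m K Ub), (fun x => lift K Ub n m L (h x)).
  split; [apply Gs_is_CA|]. split; [|split].
  - intros x y E. now apply I, (lift_inj K Ub n m L Hn).
  - intros. now apply lift_closed.
  - apply (ca_hom_compose n C (Gs n K Ub)); [exact Hh | apply lift_hom].
Qed.

(** * The complex algebra outside dimension six, and the conclusion *)

Lemma ca_hom_comp (n : nat) (A B : CAsig) (f : A -> B) (x y : A) :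
  3 <= n -> ca_hom n A B f ->
  f (ra_comp_of A x y) = ra_comp_of B (f x) (f y).
Proof.
  intros Hn (F1 & F2 & F3 & F4 & F5 & F6 & F7).
  unfold ra_comp_of, ca_subst.
  repeat (rewrite ?F2, ?F6, ?F7 by lia). reflexivity.
Qed.

Lemma rainbow_not_in_SRaCA (m : nat) (D : CAsig) (e : CmRA rainbow -> D) :
  6 <= m -> is_CA m D -> injective e ->
  (forall X i, 2 <= i < m -> ca_cyl D i (e X) = e X) ->
  (forall X Y, e (ra_join _ X Y) = ca_join D (e X) (e Y)) ->
  (forall X Y, e (ra_meet _ X Y) = ca_meet D (e X) (e Y)) ->
  e (ra_zero _) = ca_zero D -> e (ra_one _) = ca_one D ->
  (forall X Y, e (ra_comp _ X Y) = ra_comp_of D (e X) (e Y)) -> False.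
Proof.
  intros Hm HD I T EJ EM EZ EO EC.
  pose (single := fun a : atom => (fun u => u = a) : CmRA rainbow).
  (* All reds of one type and one sign: an element of the complex algebra that is not tame, hence
     not in the term algebra. *)
  pose (red := fun i j s => (fun u => exists l, u = Red i j (s, l)) : CmRA rainbow).
  pose (yb := (fun u => u = Yellow \/ u = Black) : CmRA rainbow).
  pose (rest := fun i j => (fun u => ~ yb u /\ ~ red i j false u /\ ~ red i j true u)
    : CmRA rainbow).
  assert (Z : forall X Y Z : CmRA rainbow,
    (forall a b c, X a -> Y b -> Z c -> ~ consistent (emb a) (emb b) (emb c)) ->
    ca_meet D (ra_comp_of D (e X) (e Y)) (e Z) = ca_zero D).
  { intros X Y W H. rewrite <- EC, <- EM, <- EZ. f_equal. apply set_ext.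
    intro c. split; [|intros []]. intros [(a & b & HX & HY & C) HZ].
    exact (H a b c HX HY HZ C). }
  apply (four_cones_contradiction m D Hm HD (e (single White)) (e (single Yellow))
    (e yb) (fun i => e (single (Green i))) (fun i j => e (rest i j))
    (fun i j s => e (red i j s)) twist);
    try (repeat intro; now apply T).
  - rewrite <- EZ. intro E. apply I in E. apply (f_equal (fun X => X White)) in E.
    change (ra_zero (CmRA rainbow) White). now rewrite <- E.
  - intros i _. unfold ca_le. rewrite <- EC, <- EM. f_equal. apply set_ext.
    intro u. split; [now intros [H _]|]. intros ->. split; [reflexivity|].
    exists (Green i), Yellow. repeat split.
  (* Over two different greens, [Id], greens and white are forbidden, and a red must have type
     [(i, j)], which [rest i j] leaves out. *)
  - intros i j N. apply Z. intros a b c -> (Hy & H0 & H1) -> C.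
    destruct b as [ |k| | | |k l [[|] h]]; simpl in C; try tauto.
    + congruence.
    + apply Hy; now left.
    + apply Hy; now right.
    + destruct C as [-> ->]. apply H1. now exists h.
    + destruct C as [-> ->]. apply H0. now exists h.
  - apply Z. intros a b c [->| ->] -> -> C; exact C.
  - intros i j. rewrite <- EO, <- !EJ. unfold ca_le. rewrite <- EM. f_equal.
    apply set_ext. intro u. split; [now intros [H _]|]. intros _. split; [exact Logic.I|].
    simpl. unfold cmr_join, rest. tauto.
  - intros i j k s s' s'' N. apply Z.
    intros a b c (l & ->) (l' & ->) (l'' & ->) C. simpl in C. tauto.
  (* The parity of [twist] on the four triples is computed. *)
  - reflexivity.
Qed.

Theorem mainTheorem7 (n : nat) (Hn : 3 <= n)
  (Hyp : forall A : RAsig, is_RA A -> simple_RA A -> atomic_RA A ->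
     exists H : CAatomstr,
       (representable_RA (TmRA (AtRA A)) -> RCA n (TmCA n H)) /\
       embeds_in_Ra n (CmRA (AtRA A)) (CmCA H)) :
  forall k : nat, 3 <= k -> ~ closed_under_completions (SNr n (n + k)).
Proof.
  intros k Hk Closed.
  destruct (Hyp (TmRA rainbow)) as (H & Hrep & g & GI & GF & GJ & GM & _ & GZ & GO & GC & _).
  - exact (representation_is_RA _ _ rep rep_inj rep_hom).
  - exact (representation_simple _ _ rep (inhabits 0) rep_inj rep_hom).
  - apply TmRA_atomic.
  - assert (R : RCA n (TmCA n H)).
    { apply Hrep, representable_AtRA.
      exists nat, (fun _ _ => True), rep. split; [now repeat split|].
      split; [exact rep_inj | exact rep_hom]. }
    apply (RCA_SNr n (n + k)) in R; [|lia|lia].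
    (* The completion of [TmCA n H] is now neatly embedded in [D], of dimension [n + k], which is at
       least 6. *)
    destruct (Closed _ R (TmCA_atomic n H)) as (D & f & HD & FI & FF & Fh).
    assert (Ph := ca_hom_compose _ _ _ _ _ _ (ca_push_hom n H) Fh).
    destruct (ra_push_hom rainbow) as (PJ & PM & _ & PZ & PO & PC & _).
    set (q := fun x => f (ca_push n H x)) in Ph.
    assert (QC := fun x y => ca_hom_comp n _ _ q x y Hn Ph).
    destruct Ph as (QJ & QM & _ & QZ & QO & QY & _).
    apply (rainbow_not_in_SRaCA (n + k) D (fun X => q (g (ra_push rainbow X))));
      try assumption; try lia.
    + intros X Y E. now apply ra_push_inj, GI, (ca_push_inj n H), FI.
    (* Closure under the coordinates below [n] comes from the embedding into the relation algebra
       reduct, and under the others from the neat embedding. *)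
    + intros X i Hi. destruct (Nat.lt_ge_cases i n) as [L|L].
      * rewrite <- QY by exact L. now rewrite GF by lia.
      * apply FF; lia.
    + intros. now rewrite PJ, GJ, QJ.
    + intros. now rewrite PM, GM, QM.
    + now rewrite PZ, GZ, QZ.
    + now rewrite PO, GO, QO.
    + intros. now rewrite PC, GC, QC.
Qed.
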